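(* Let $C$ be a binary cycle code defined by a parity-check matrix $H$ with normal graph $N = N(H)$, let $n$ be the number of edges $e_1,\dots,e_n$ of $N$ (equivalently, the number of columns of $H$), and let $\zeta_N(u_1,\dots,u_n) \in \mathbb{Z}[[u_1,\dots,u_n]]$ be the edge zeta function of $N$. Then: (1) A vector $p=(p_1,\dots,p_n)\in\mathbb{N}^n$, where $\mathbb{N}=\{1,2,3,\dots\}$, is an unscaled pseudo-codeword for $C$ if and only if there is a backtrackless, tailless cycle in $N$ which uses the edge $e_i$ exactly $p_i$ times for each $1\le i\le n$. (2) The unscaled pseudo-codewords of $C$ are in one-to-one correspondence with the monomials appearing with nonzero coefficient in $\zeta_N$, a monomial $u_1^{p_1}\cdots u_n^{p_n}$ corresponding to its exponent vector $(p_1,\dots,p_n)$. (3) The Newton polyhedron of $\zeta_N$, i.e. the convex hull in $\mathbb{R}^n$ of the exponent vectors of the monomials appearing with nonzero coefficient in the power series $\zeta_N$, equals the fundamental cone $K(H)$.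
   Context: **Codes and graphs.** Let $H=(h_{ji})$ be a binary matrix with row index set $J$ and column index set $I=\{1,\dots,n\}$, $n\ge 1$. For $i\in I$ let $J_i=\{j\in J: h_{ji}=1\}$, and for $j\in J$ let $I_j=\{i\in I: h_{ji}=1\}$. The code defined by $H$ is $C=\{x\in\mathbb{F}_2^n : \sum_{i\in I_j}x_i=0 \text{ in } \mathbb{F}_2 \text{ for all } j\in J\}$. It is called a *cycle code* if $|J_i|=2$ for all $i\in I$. In that case the *normal graph* $N(H)$ is the undirected graph with vertex set $J$ and edges $e_1,\dots,e_n$, where $e_i$ joins the two elements of $J_i$. All graphs are assumed to have no self-loops and no multiple edges (so the columns of $H$ are pairwise distinct). **Fundamental cone.** $K(H)$ is the set of $\omega\in\mathbb{R}^n$ such that $\omega_i\ge0$ for all $i\in I$, and $\sum_{i'\in I_j\setminus\{i\}}\omega_{i'}\ge\omega_i$ for all $j\in J$ and all $i\in I_j$. **Covers and pseudo-codewords.** The Tanner graph $T(H)$ is the bipartite graph with bit nodes $I$, check nodes $J$, and an edge between $i$ and $j$ iff $h_{ji}=1$. For a positive integer $M$ write $[M]=\{1,\dots,M\}$. An $M$-fold cover $\widetilde T$ of $T(H)$ is specified by a choice of permutations $\pi_{j,i}$ of $[M]$, one for each $j\in J$ and $i\in I_j$: it has bit nodes $I\times[M]$ and check nodes $J\times[M]$, and check node $(j,m)$ is joined to bit node $(i,\pi_{j,i}(m))$ for each $i\in I_j$. The code $\widetilde C\subseteq\mathbb{F}_2^{I\times[M]}$ described by $\widetilde T$ is the set of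 all $\widetilde c=(\widetilde c_{i,m})$ with $\sum_{i\in I_j}\widetilde c_{i,\pi_{j,i}(m)}=0$ in $\mathbb{F}_2$ for all $j\in J$, $m\in[M]$. The *unscaled pseudo-codeword* associated with $\widetilde c\in\widetilde C$ is the integer vector whose $i$-th entry is $\sum_{m\in[M]}\widetilde c_{i,m}$, where $\widetilde c_{i,m}\in\{0,1\}$ and the sum is taken in $\mathbb{R}$. A vector is an unscaled pseudo-codeword for $C$ if it arises in this way from some $M\ge1$, some $M$-fold cover $\widetilde T$ of $T(H)$ and some $\widetilde c\in\widetilde C$. **Edge zeta function.** Let $X$ be a graph with edges $e_1,\dots,e_n$. A *cycle* on $X$ is a sequence $\Gamma=(e_{i_1},\dots,e_{i_k})$ of edges (repetitions allowed) that can be directed so that $e_{i_s}$ terminates where $e_{i_{s+1}}$ begins for $1\le s\le k-1$ and $e_{i_k}$ terminates where $e_{i_1}$ begins. It is *backtrackless* if $e_{i_s}\neq e_{i_{s+1}}$ for all $1\le s\le k-1$, *tailless* if $e_{i_1}\ne e_{i_k}$, and *primitive* if there is no cycle $\Theta$ and $r\ge2$ such that $\Gamma=\Theta^r$ (i.e. $\Gamma$ is $\Theta$ followed $r$ times). Two cycles of length $k$ are *equivalent* if one edge sequence is a cyclic shift of the other. The monomial of $\Gamma$ is $g(\Gamma)=u_{i_1}\cdots u_{i_k}$. The *edge zeta function* of $X$ is the formal power series $$\zeta_X(u_1,\dots,u_n)=\prod_{[\Gamma]\in A(X)}\bigl(1-g(\Gamma)\bigr)^{-1},$$ where $A(X)$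 is the set of equivalence classes of backtrackless, tailless, primitive cycles on $X$.
   Formalization: In (1), the direction from pseudo-codeword to cycle is proved only when all edges of N lie in one connected component; without this it is false: for two disjoint triangles, p = (1,1,1,1,1,1) is a pseudo-codeword but no single cycle uses all six edges. *)

(* Defs.v *)
From HB Require Import structures.
From mathcomp Require Import all_boot all_order all_algebra all_fingroup.
From mathcomp Require Import boolp classical_sets functions reals convex.

Set Implicit Arguments.
Unset Strict Implicit.
Unset Printing Implicit Defensive.

Import Order.TTheory GRing.Theory Num.Theory.

Local Open Scope ring_scope.

(** * Parity-check matrices *)

Definition checks_of (m n : nat) (H : 'M['F_2]_(m, n)) (i : 'I_n) :
  {set 'I_m} := [set j | H j i == 1].

Definition bits_of (m n : nat) (H : 'M['F_2]_(m, n)) (j : 'I_m) :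
  {set 'I_n} := [set i | H j i == 1].

Definition cycle_code_matrix (m n : nat) (H : 'M['F_2]_(m, n)) : Prop :=
  forall i : 'I_n, #|checks_of H i| = 2.

(** ** Fundamental cone *)

Definition fundamental_cone (R : realType) (m n : nat)
    (H : 'M['F_2]_(m, n)) : set 'rV[R]_n :=
  [set w | (forall i : 'I_n, 0 <= w 0 i) /\
           (forall (j : 'I_m) (i : 'I_n), i \in bits_of H j ->
              w 0 i <= \sum_(i' in bits_of H j :\ i) w 0 i')]%classic.

Arguments fundamental_cone R {m n} H.

(** ** Covers of the Tanner graph and pseudo-codewords *)

(* An M-fold cover is a family of permutations of the M sheets, indexed by the
   pairs (j, i); only its values at the edges of the Tanner graph, i.e. at the
   pairs with [i \in bits_of H j], are ever used. *)
Definition cover_code (m n M : nat) (H : 'M['F_2]_(m, n))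
    (pi : 'I_m -> 'I_n -> {perm 'I_M}) (c : 'M['F_2]_(n, M)) : Prop :=
  forall (j : 'I_m) (s : 'I_M),
    \sum_(i in bits_of H j) c i (pi j i s) = 0.

(* Vectors of nonnegative integers are row vectors over [nat]; an element of
   ['F_2] is read as the natural number 0 or 1 through [nat_of_ord]. *)
Definition unscaled_pseudocodeword (m n : nat) (H : 'M['F_2]_(m, n))
    (p : 'rV[nat]_n) : Prop :=
  exists (M : nat) (pi : 'I_m -> 'I_n -> {perm 'I_M}) (c : 'M['F_2]_(n, M)),
    [/\ (0 < M)%N, cover_code H pi c
      & forall i : 'I_n, p 0 i = (\sum_(s < M) nat_of_ord (c i s))%N].

(** * Graphs with numbered edges *)

(* A graph with vertex set [V] and edges [e_1, ..., e_n] is given by the map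
   sending the index of an edge to the set of its endpoints. It has no
   self-loops iff all these sets have two elements, and no multiple edges iff
   the map is injective. *)
Definition edge_graph (V : finType) (n : nat) : Type := 'I_n -> {set V}.

Definition normal_graph (m n : nat) (H : 'M['F_2]_(m, n)) :
  edge_graph 'I_m n := checks_of H.

Definition adjacent (V : finType) (n : nat) (X : edge_graph V n) : rel V :=
  [rel u v | [exists i : 'I_n, X i == [set u; v]%SET]].

(* Any two edges lie in the same connected component; isolated vertices are
   allowed. A single cycle stays in one component, so a vector with positive
   entries can be realised by one cycle only for such graphs: on two disjoint
   triangles the all-one vector is a codeword but not the count of a cycle. *)
Definition edge_connected (V : finType) (n : nat) (X : edge_graph V n) : Prop :=
  forall (i i' : 'I_n) (u v : V),
    u \in X i -> v \in X i' -> connect (adjacent X) u v.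

(** ** Cycles *)

(* [v k] is the vertex where the k-th edge of the directed cycle begins;
   [ordS] is the successor modulo the length. *)
Definition is_cycle (V : finType) (n : nat) (X : edge_graph V n)
    (G : seq 'I_n) : bool :=
  (G != [::]) &&
  [exists v : {ffun 'I_(size G) -> V}, forall k : 'I_(size G),
     X (tnth (in_tuple G) k) == [set v k; v (ordS k)]%SET].

Definition backtrackless (n : nat) (G : seq 'I_n) : bool :=
  sorted [rel e f | e != f] G.

Definition tailless (n : nat) (G : seq 'I_n) : bool :=
  if G is e :: G' then e != last e G' else true.

Definition primitive (V : finType) (n : nat) (X : edge_graph V n)
    (G : seq 'I_n) : Prop :=
  ~ exists (T : seq 'I_n) (r : nat),
      [/\ is_cycle X T, (2 <= r)%N & G = flatten (nseq r T)].

Definition cyclic_shift (n k : nat) : rel (k.-tuple 'I_n) :=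
  [rel G G' | [exists r : 'I_k.+1, tval G' == rot r G]].

Definition prime_cycles (V : finType) (n : nat) (X : edge_graph V n)
    (k : nat) : {set k.-tuple 'I_n} :=
  [set G : k.-tuple 'I_n |
     `[< [/\ is_cycle X G, backtrackless G, tailless G & primitive X G] >]]%SET.

Definition prime_classes (V : finType) (n : nat) (X : edge_graph V n)
    (k : nat) : {set {set k.-tuple 'I_n}} :=
  equivalence_partition (@cyclic_shift n k) (prime_cycles X k).

Definition prime_representatives (V : finType) (n : nat) (X : edge_graph V n)
    (k : nat) : {set k.-tuple 'I_n} :=
  transversal (prime_classes X k) (prime_cycles X k).

Definition multiplicities (n : nat) (G : seq 'I_n) : 'rV[nat]_n :=
  \row_i count_mem i G.

(** * Power series in n variables with integer coefficients *)

(* A power series maps an exponent vector to the coefficient of the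
   corresponding monomial. *)
Definition pseries (n : nat) : Type := 'rV[nat]_n -> int.

Definition degree (n : nat) (d : 'rV[nat]_n) : nat := (\sum_i d 0%R i)%N.

Definition ps_monomial (n : nat) (e : 'rV[nat]_n) : pseries n :=
  fun d => (d == e)%:R.

Definition ps_one (n : nat) : pseries n := ps_monomial 0.
Arguments ps_one n : clear implicits.

Definition ps_sub (n : nat) (f g : pseries n) : pseries n :=
  fun d => f d - g d.

(* The coefficient at [d] sums [f a * g b] over all [a + b = d]; the entries
   of such [a] and [b] are at most [degree d]. *)
Definition nat_row (n k : nat) (a : 'rV['I_k]_n) : 'rV[nat]_n :=
  map_mx (@nat_of_ord k) a.

Definition ps_mul (n : nat) (f g : pseries n) : pseries n := fun d =>
  \sum_(ab : 'rV['I_(degree d).+1]_n * 'rV['I_(degree d).+1]_n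
        | nat_row ab.1 + nat_row ab.2 == d)
     f (nat_row ab.1) * g (nat_row ab.2).

Definition ps_pow (n : nat) (f : pseries n) (k : nat) : pseries n :=
  iter k (ps_mul f) (ps_one n).

(* The inverse of a power series with constant coefficient 1, as the sum of
   the powers of [1 - f]; the k-th power has no term of degree less than k.
   See [ps_mulV]. *)
Definition ps_inv (n : nat) (f : pseries n) : pseries n := fun d =>
  \sum_(k < (degree d).+1) ps_pow (ps_sub (ps_one n) f) k d.

(** * Edge zeta function *)

Definition zeta_factor (V : finType) (n : nat) (X : edge_graph V n) (k : nat) :
    pseries n :=
  \big[@ps_mul n/ps_one n]_(G in prime_representatives X k)
     ps_inv (ps_sub (ps_one n) (ps_monomial (multiplicities G))).

Definition zeta_upto (V : finType) (n : nat) (X : edge_graph V n) (L : nat) :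
    pseries n :=
  \big[@ps_mul n/ps_one n]_(0 <= k < L.+1) zeta_factor X k.

(* The infinite product is the coefficientwise limit of the products over the
   classes of length at most L: the coefficient at [d] is constant for
   [L >= degree d]. See [zeta_upto_stable]. *)
Definition edge_zeta (V : finType) (n : nat) (X : edge_graph V n) : pseries n :=
  fun d => zeta_upto X (degree d) d.

(** * Newton polyhedron *)

Definition convex_hull (R : realType) (n : nat) (A : set 'rV[R]_n) :
  set 'rV[R]_n := smallest (@convex_set R 'rV[R]_n) A.

Definition newton_polyhedron (R : realType) (n : nat) (f : pseries n) :
  set 'rV[R]_n :=
  convex_hull [set map_mx (fun k : nat => k%:R : R) d | d in [set d | f d != 0]]%classic.

Arguments newton_polyhedron R {n} f.

(** * Soundness of the constructions *)

Lemma cyclic_shift_equiv (n k : nat) : equivalence_rel (@cyclic_shift n k).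
Proof.
apply/equivalence_relP; split=> [G|].
  by apply/existsP; exists ord0; rewrite rot0.
have shiftC (G G' : k.-tuple 'I_n) : cyclic_shift G G' -> cyclic_shift G' G.
  case/existsP=> r /eqP G'E; apply/existsP; exists (inord (k - r)).
  have sG' : size (rot r G) = k by rewrite size_rot size_tuple.
  rewrite G'E inordK ?ltnS ?leq_subr // -{1}(rotK r G) /rotr.
  by rewrite sG'.
have shift_trans (G G' G'' : k.-tuple 'I_n) :
    cyclic_shift G G' -> cyclic_shift G' G'' -> cyclic_shift G G''.
  case/existsP=> r /eqP G'E /existsP[r' /eqP G''E]; apply/existsP.
  have bounded (a : 'I_k.+1) : (a <= size G)%N by rewrite size_tuple -ltnS.
  rewrite G''E G'E rot_add_mod //.
  set j := (if _ then _ else _); have jk : (j <= k)%N.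
    have := bounded r; have := bounded r'; rewrite /j size_tuple => rk r'k.
    by case: (leqP (r' + r) k) => // _; rewrite leq_subLR leq_add.
  by exists (inord j); rewrite inordK.
by move=> G G' GG'; move=> G''; apply/idP/idP; apply: shift_trans => //; apply: shiftC.
Qed.

Lemma prime_classes_partition (V : finType) (n : nat) (X : edge_graph V n)
    (k : nat) : finset.partition (prime_classes X k) (prime_cycles X k).
Proof.
by apply: equivalence_partitionP => G G' G'' _ _ _; exact: cyclic_shift_equiv.
Qed.

Section PowerSeriesFacts.
Variable n : nat.
Implicit Types (f g h : pseries n) (a b d e : 'rV[nat]_n).

Lemma degreeD a b : degree (a + b) = (degree a + degree b)%N.
Proof. by rewrite /degree -big_split; apply: eq_bigr => i _; rewrite mxE. Qed.

Lemma degree_eq0 d : (degree d == 0%N) = (d == 0).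
Proof.
apply/idP/eqP => [|->].
  rewrite sum_nat_eq0 => /forallP d0; apply/rowP => i; rewrite mxE.
  exact/eqP/(implyP (d0 i)).
by rewrite /degree big1 // => i _; rewrite mxE.
Qed.

Lemma leq_coef_degree d i : (d ord0 i <= degree d)%N.
Proof. by rewrite /degree (bigD1 i) //= leq_addr. Qed.

Lemma ps_mul_agree (f f' g g' : pseries n) d :
  (forall a, (degree a <= degree d)%N -> f a = f' a) ->
  (forall b, (degree b <= degree d)%N -> g b = g' b) ->
  ps_mul f g d = ps_mul f' g' d.
Proof.
move=> ff' gg'; apply: eq_bigr => -[a b] /= /eqP /(congr1 (@degree n)).
rewrite degreeD => abd; congr (_ * _); [apply: ff' | apply: gg'].
  by rewrite -[X in (_ <= X)%N]abd leq_addr.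
by rewrite -[X in (_ <= X)%N]abd leq_addl.
Qed.

Lemma ps_mulBl f g h d :
  ps_mul (ps_sub f g) h d = ps_mul f h d - ps_mul g h d.
Proof. by rewrite /ps_mul -sumrB; apply: eq_bigr => ab _; rewrite -mulrBl. Qed.

Lemma ps_mul1l f d : ps_mul (ps_one n) f d = f d.
Proof.
pose z : 'rV['I_(degree d).+1]_n := const_mx ord0.
pose d' : 'rV['I_(degree d).+1]_n := \row_i inord (d 0 i).
have Ez : nat_row z = 0 by apply/rowP => i; rewrite !mxE.
have Ed : nat_row d' = d.
  by apply/rowP => i; rewrite !mxE inordK // ltnS leq_coef_degree.
rewrite /ps_mul (bigD1 (z, d')) /= ?Ez ?Ed ?add0r //.
rewrite /ps_one /ps_monomial eqxx mul1r big1 ?addr0 // => -[a b] /= /andP[/eqP abd neq].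
case: eqP => [a0|_]; last by rewrite mul0r.
case/negP: neq; rewrite a0 add0r in abd; apply/eqP; congr (_, _).
  by apply/rowP => i; apply/val_inj; have /rowP/(_ i) := a0; rewrite !mxE.
by apply/rowP => i; apply/val_inj; have /rowP/(_ i) := abd; rewrite -{2}Ed !mxE.
Qed.

Lemma ps_pow_low h k d : h 0 = 0 -> (degree d < k)%N -> ps_pow h k d = 0.
Proof.
move=> h0; elim: k d => [//|k IHk] d; rewrite ltnS => dk.
rewrite /ps_pow iterS -/(ps_pow h k) /ps_mul big1 // => -[a b] /=.
move=> /eqP/(congr1 (@degree n)); rewrite degreeD => abd.
have [->|a0] := eqVneq (nat_row a) 0; first by rewrite h0 mul0r.
rewrite (IHk (nat_row b)) ?mulr0 //; apply: leq_trans dk.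
by rewrite -[X in (_ <= X)%N]abd -[X in (X < _)%N]add0n ltn_add2r
  lt0n degree_eq0.
Qed.

Lemma ps_mulV f : f 0 = 1 -> ps_mul f (ps_inv f) =1 ps_one n.
Proof.
move=> f0 d; pose h := ps_sub (ps_one n) f.
have h0 : h 0 = 0 by rewrite /h /ps_sub f0 /ps_one /ps_monomial eqxx subrr.
rewrite (@ps_mul_agree f (ps_sub (ps_one n) h) (ps_inv f) (ps_inv f)) //; last first.
  by move=> a _; rewrite /h /ps_sub subKr.
rewrite ps_mulBl ps_mul1l.
have E b : (degree b <= degree d)%N ->
    ps_inv f b = \sum_(k < (degree d).+1) ps_pow h k b.
  move=> bd; rewrite /ps_inv -/h.
  rewrite (big_ord_widen (degree d).+1 (fun k => ps_pow h k b)) // big_mkcond.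
  apply: eq_bigr => k _; case: ifPn => //; rewrite -leqNgt => bk.
  by rewrite ps_pow_low.
rewrite (E d) // (@ps_mul_agree h h _ _ d _ E) //.
have -> : ps_mul h (fun b => \sum_(k < (degree d).+1) ps_pow h k b) d =
    \sum_(k < (degree d).+1) ps_pow h k.+1 d.
  rewrite /ps_mul; under eq_bigr do rewrite mulr_sumr.
  by rewrite exchange_big.
rewrite big_ord_recl [X in _ - X]big_ord_recr.
rewrite [X in _ - (_ + X)]ps_pow_low //= addr0; exact: addrK.
Qed.

Lemma ps_inv_agree_one f N :
  (forall a, (degree a <= N)%N -> f a = ps_one n a) ->
  forall d, (degree d <= N)%N -> ps_inv f d = ps_one n d.
Proof.
move=> f1 d dN; rewrite -[RHS](@ps_mulV f).
  rewrite -[LHS]ps_mul1l; apply: ps_mul_agree => // a ad.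
  by rewrite f1 // (leq_trans ad).
by rewrite f1 /ps_one /ps_monomial ?eqxx // (eqP (_ : degree 0 == 0%N)) ?degree_eq0.
Qed.

End PowerSeriesFacts.

Lemma degree_multiplicities (n : nat) (G : seq 'I_n) :
  degree (multiplicities G) = size G.
Proof.
rewrite -sum1_size /degree; under eq_bigr do rewrite mxE -sum1_count.
rewrite (exchange_big_dep xpredT) //=; apply: eq_bigr => j _.
by rewrite (big_pred1 j) // => i; rewrite eq_sym.
Qed.

Lemma zeta_upto_stable (V : finType) (n : nat) (X : edge_graph V n)
    (d : 'rV[nat]_n) (L : nat) :
  (degree d <= L)%N -> zeta_upto X L d = edge_zeta X d.
Proof.
move=> dL; rewrite /edge_zeta /zeta_upto.
have F1 k e : (degree e < k)%N -> zeta_factor X k e = ps_one n e.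
  rewrite /zeta_factor; move: e; apply: (big_ind (fun f : pseries n =>
    forall e, (degree e < k)%N -> f e = ps_one n e)) => //.
    move=> f g f1 g1 e ek; rewrite -[RHS]ps_mul1l; apply: ps_mul_agree => a ae.
      by rewrite f1 // (leq_ltn_trans ae).
    by rewrite g1 // (leq_ltn_trans ae).
  move=> G _ e; case: k G => // k G; rewrite ltnS => ek.
  apply: (@ps_inv_agree_one n _ k) => // a ak.
  rewrite /ps_sub [ps_monomial _ a]/ps_monomial; case: eqP => [aG|]; last first.
    by rewrite subr0.
  by move: ak; rewrite aG degree_multiplicities size_tuple ltnn.
pose agree (f g : pseries n) :=
  forall e, (degree e <= degree d)%N -> f e = g e.
have cut (s : seq nat) : agree (\big[@ps_mul n/ps_one n]_(k <- s) zeta_factor X k)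
    (\big[@ps_mul n/ps_one n]_(k <- s | (k <= degree d)%N) zeta_factor X k).
  elim: s => [|k s IHs] e ed; rewrite ?big_nil // !big_cons; case: leqP => dk.
    by apply: ps_mul_agree => // a ae; exact/IHs/(leq_trans ae).
  rewrite -IHs // -[RHS]ps_mul1l; apply: ps_mul_agree => // a ae.
  exact/F1/(leq_ltn_trans ae)/(leq_ltn_trans ed).
rewrite cut // (cut (index_iota 0 (degree d).+1)) //.
rewrite -big_filter -[in RHS]big_filter; congr (bigop _ _ _ d).
rewrite /index_iota !subn0 -(subnKC dL) -addSn iotaD filter_cat.
rewrite [X in _ ++ X](eq_in_filter (a2 := pred0)) ?filter_pred0 ?cats0 //.
by move=> k; rewrite mem_iota add0n => /andP[dk _]; rewrite leqNgt dk.
Qed.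

(* Main.v *)
(** Everything goes through one arithmetic condition on a vector [p] of edge
    multiplicities: at every vertex the multiplicities of the incident edges have
    an even sum, and none of them exceeds half of it. Pseudo-codewords and counts
    of backtrackless tailless cycles satisfy it locally. Conversely, split the
    list of copies of edges at a vertex, grouped by edge, into two halves, and
    match the k-th entries of the halves: this pairs each copy with a copy of
    another edge. Using the pairs as check nodes gives a cover with a codeword;
    following the pairs from edge to edge decomposes [p] into backtrackless
    tailless cycles, which can be merged into one when the graph is connected.
    The coefficients of the zeta function are nonnegative, so its support is the
    monoid generated by the prime cycles, that is, all such [p]. Finally, even
    integral points of the fundamental cone satisfy the condition, and the cone
    is the convex hull of these points because it is a rational cone. *)

Require Import Defs.
From mathcomp Require Import all_boot all_order all_algebra all_fingroup.
From mathcomp Require Import boolp classical_sets functions reals convex.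
From mathcomp Require Import interval_inference zify ring.

Set Implicit Arguments.
Unset Strict Implicit.
Unset Printing Implicit Defensive.

Import Order.TTheory GRing.Theory Num.Theory.

Local Open Scope ring_scope.

Local Notation cycle := path.cycle.

(** * Pseudo-codewords *)

(** The sum includes [i] itself, so the inequality is that of the fundamental cone at [v] with [p i]
    added to both sides. *)
Definition balanced (V : finType) (n : nat) (X : edge_graph V n)
    (p : 'rV[nat]_n) : Prop :=
  forall v : V, ~~ odd (\sum_(i | v \in X i) p ord0 i)%N /\
    forall i, v \in X i ->
      ((p ord0 i).*2 <= \sum_(i' | v \in X i') p ord0 i')%N.

Lemma F2_natr_eq0 (k : nat) : (k%:R == 0 :> 'F_2) = ~~ odd k.
Proof. by rewrite -(dvdn_pcharf (pchar_Fp (isT : prime 2))) dvdn2. Qed.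

Lemma F2_sum_eq0 (I : finType) (P : pred I) (F : I -> 'F_2) :
  (\sum_(i | P i) F i == 0) = ~~ odd (\sum_(i | P i) nat_of_ord (F i))%N.
Proof.
rewrite -F2_natr_eq0 natr_sum; congr (_ == _).
by apply: eq_bigr => i _; rewrite natr_Zp.
Qed.

Lemma F2_ord_lt2 (x : 'F_2) : (nat_of_ord x < 2)%N.
Proof. exact: (ltn_ord x). Qed.

(** Each lifted check sees a 0-1 word of even weight, in which no bit exceeds the sum of the others.
    Parity and inequality survive summation over the [M] sheets. *)
Lemma pseudocodeword_balanced (m n : nat) (H : 'M['F_2]_(m, n))
    (p : 'rV[nat]_n) :
  unscaled_pseudocodeword H p -> balanced (normal_graph H) p.
Proof.
move=> [M [pi [c [M0 cov pE]]]] j.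
have bitsE i : (j \in normal_graph H i) = (i \in bits_of H j) by rewrite !inE.
under eq_bigl do rewrite bitsE.
have shift i : p ord0 i = (\sum_(s < M) nat_of_ord (c i (pi j i s)))%N.
  by rewrite pE (reindex_inj (@perm_inj _ (pi j i))).
have even s : ~~ odd (\sum_(i in bits_of H j) nat_of_ord (c i (pi j i s)))%N.
  by rewrite -F2_sum_eq0 cov.
have -> : (\sum_(i in bits_of H j) p ord0 i =
  \sum_(s < M) \sum_(i in bits_of H j) nat_of_ord (c i (pi j i s)))%N.
  by rewrite exchange_big; apply: eq_bigr => i _; exact: shift.
split=> [|i]; last rewrite bitsE => ji.
  by elim/big_rec: _ => // s x _ ox; rewrite oddD (negbTE (even s)).
rewrite shift -mul2n big_distrr /=; apply: leq_sum => s _.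
have := even s; rewrite (bigD1 i) //=; have := F2_ord_lt2 (c i (pi j i s)).
by case: (nat_of_ord _) => [|[|]] // _; case: (\sum_(_ in _ | _) _)%N.
Qed.

(** Equal entries at positions [k] and [k + h] of a sorted list enclose [h + 1] equal entries, one
    more than the bound [h] allows. *)
Lemma sorted_nth_shift_neq (s : seq nat) (h k : nat) :
  sorted leq s -> (forall x, (count_mem x s <= h)%N) -> (k + h < size s)%N ->
  nth 0%N s k != nth 0%N s (k + h).
Proof.
move=> ss cs khs; apply/negP => /eqP E; set x := nth 0%N s k in E.
have := cs x; apply/negP; rewrite -ltnNge.
have sz : size (take h.+1 (drop k s)) = h.+1.
  by rewrite size_takel // size_drop; lia.
have all_x : all (pred1 x) (take h.+1 (drop k s)).
  apply/(all_nthP 0%N) => l; rewrite sz => lh; rewrite /= nth_take // nth_drop.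
  have mono a b : (a <= b)%N -> (b < size s)%N -> (nth 0%N s a <= nth 0%N s b)%N.
    move=> ab bs; apply: (sorted_leq_nth leq_trans leqnn) => //.
    exact: leq_ltn_trans bs.
  rewrite eqn_leq {1}E /x !mono //; lia.
move: all_x; rewrite all_count sz => /eqP <-.
rewrite -{2}(cat_take_drop k s) count_cat -{2}(cat_take_drop h.+1 (drop k s)).
by rewrite count_cat; lia.
Qed.

(** * Lists of edge copies at a vertex and their pairing *)

Section DartList.
Variables (V : finType) (n : nat) (X : edge_graph V n) (p : 'rV[nat]_n).

(* The edges at [v], the [i]-th one in [p i] copies [(i, t)]. Copies of one
   edge are consecutive, so that pairing the two halves of the list never pairs
   two copies of the same edge when [p] is balanced. *)
Definition dart_list (v : V) : seq ('I_n * nat) :=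
  [seq (i, t) | i <- enum [pred i | v \in X i], t <- iota 0 (p ord0 i)].

Lemma mem_dart_list v i t :
  ((i, t) \in dart_list v) = (v \in X i) && (t < p ord0 i)%N.
Proof.
apply/allpairsPdep/andP => [[i' [t' [+ + [-> ->]]]]|[vi tp]].
  by rewrite mem_enum mem_iota.
by exists i, t; rewrite mem_enum mem_iota.
Qed.

Lemma dart_list_uniq v : uniq (dart_list v).
Proof.
apply: allpairs_uniq_dep => [|i _|]; rewrite ?enum_uniq ?iota_uniq //.
by move=> [i t] [i' t'] _ _ /= [-> ->].
Qed.

Lemma map_dart_list v : [seq x.1 | x <- dart_list v] =
  flatten [seq nseq (p ord0 i) i | i <- enum [pred i | v \in X i]].
Proof.
rewrite map_flatten -map_comp; congr flatten; apply: eq_map => i /=.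
rewrite -map_comp; move: (p _ _) => k.
by elim: k 0%N => //= k IHk l; rewrite IHk.
Qed.

Lemma size_dart_list v : size (dart_list v) = (\sum_(i | v \in X i) p ord0 i)%N.
Proof.
rewrite -(size_map fst) map_dart_list size_flatten /shape -map_comp sumnE.
by rewrite big_map -big_enum; apply: eq_bigr => i _ /=; rewrite size_nseq.
Qed.

Lemma count_dart_list v i :
  count (fun x => x.1 == i) (dart_list v) = ((v \in X i) * p ord0 i)%N.
Proof.
rewrite -(count_map fst (pred1 i)) map_dart_list count_flatten -map_comp sumnE.
rewrite big_map (eq_bigr (fun i' => if i' == i then p ord0 i else 0%N)).
  rewrite -big_mkcond big_enum_cond /=; case: (boolP (v \in X i)) => vi.
    by rewrite (big_pred1 i) ?mul1n // => i'; rewrite /= inE; case: eqP => [->|]; rewrite ?andbF ?vi.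
  by rewrite big_pred0 // => i'; rewrite /= inE; case: eqP => [->|]; rewrite ?andbF ?(negbTE vi).
by move=> i' _; rewrite /= count_nseq /=; case: eqP => [->|]; rewrite ?mul1n.
Qed.

Lemma sorted_dart_list v : sorted leq [seq nat_of_ord x.1 | x <- dart_list v].
Proof.
rewrite (map_comp (@nat_of_ord n) fst) map_dart_list map_flatten -map_comp.
have : sorted leq (map (@nat_of_ord n) (enum [pred i | v \in X i])).
  rewrite /enum_mem -enumT.
  apply: (subseq_sorted leq_trans (map_subseq _ (filter_subseq _ _))).
  by rewrite val_enum_ord iota_sorted.
elim: (enum _) => //= i s IHs si; have {}IHs := IHs (path_sorted si).
rewrite map_nseq; move: (p _ _) => k; elim: k => //= k IHk.
rewrite path_min_sorted ?IHk // all_cat; apply/andP; split.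
  by apply/allP => x; rewrite mem_nseq => /andP[_ /eqP ->].
apply/allP => x /flattenP[y /mapP[i' i's ->]] /=.
rewrite map_nseq mem_nseq => /andP[_ /eqP ->].
by move: si; rewrite (path_sortedE leq_trans) => /andP[/allP -> //]; exact: map_f.
Qed.

Hypothesis balp : balanced X p.

Definition half_degree (v : V) : nat := (size (dart_list v))./2.

Lemma size_dart_list_half v : size (dart_list v) = (half_degree v).*2.
Proof. by rewrite halfK size_dart_list (negbTE (balp v).1) subn0. Qed.

(** Balance bounds the copies of each edge by half of the list, and the list is sorted by edge, so
    equal edges cannot lie half a length apart. *)
Lemma opposite_dart_neq x0 v k : (k < half_degree v)%N ->
  (nth x0 (dart_list v) k).1 != (nth x0 (dart_list v) (k + half_degree v)).1.
Proof.
move=> kh; have szh := size_dart_list_half v.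
have := @sorted_nth_shift_neq _ (half_degree v) k (sorted_dart_list v).
rewrite size_map !(nth_map x0) szh -?addnn; [|lia..].
apply; last lia.
move=> l; rewrite count_map; case: (ltnP l n) => [ln|nl].
  rewrite (eq_count (a2 := fun x => x.1 == Ordinal ln)) // count_dart_list.
  case: (boolP (v \in X _)) => // vi.
  by rewrite mul1n -leq_double -szh size_dart_list (balp v).2.
rewrite (eq_count (a2 := pred0)) ?count_pred0 // => x /=.
by apply/negbTE; have := ltn_ord x.1; lia.
Qed.

End DartList.

(** List [A] before its complement and send each sheet to its index in this list. This lets the ones
    of a bit occupy its first sheets while [A] prescribes which lifted checks see them. *)
Lemma perm_sending_initial (M : nat) (A : {set 'I_M}) :
  exists pi : {perm 'I_M}, forall s, (pi s < #|A|)%N = (s \in A).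
Proof.
pose l := enum A ++ enum (~: A).
have mem_l s : s \in l by rewrite mem_cat !mem_enum inE orbN.
have sz_l : size l = M by rewrite size_cat -!cardE cardsC card_ord.
pose f s : 'I_M := Ordinal (etrans (congr1 (leq _) (esym sz_l))
  (etrans (index_mem s l) (mem_l s))).
have f_inj : injective f.
  by move=> s s' /(congr1 val) /= /(congr1 (nth s l)); rewrite !nth_index.
exists (perm f_inj) => s; rewrite permE /= index_cat mem_enum cardE.
case: ifPn => sA; first by rewrite index_mem mem_enum.
by apply/negbTE; rewrite -leqNgt leq_addr.
Qed.

(** The codeword has ones on the first [p i] sheets of each bit [i]. The cover is chosen so that a
    lifted check [(j, s)] with [s < h j] sees exactly the ones of the two different edges paired at
    positions [s] and [s + h j], and every other lifted check sees only zeros. *)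
Lemma balanced_pseudocodeword (m n : nat) (H : 'M['F_2]_(m, n))
    (p : 'rV[nat]_n) :
  balanced (normal_graph H) p -> unscaled_pseudocodeword H p.
Proof.
move=> balp; set X := normal_graph H in balp *.
case: n H @X p balp => [|n] H X p balp.
  exists 1%N, (fun _ _ => 1%g), 0; split=> // [j s|[] //].
  by rewrite big1 // => -[].
(* [M] is positive and bounds all [p i] and all [h j]; [A j i] collects the sheets [s] on which
   check [(j, s)] has to see a one of bit [i]. *)
pose M := (\sum_i p ord0 i)%N.+1; pose dl := dart_list X p.
pose h := half_degree X p; pose x0 : 'I_n.+1 * nat := (ord0, 0%N).
have szdl j : size (dl j) = (h j).*2 by exact: size_dart_list_half.
pose lab j k := (nth x0 (dl j) k).1.
pose A (j : 'I_m) (i : 'I_n.+1) : {set 'I_M} :=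
  [set s : 'I_M | (s < h j)%N && ((lab j s == i) || (lab j (s + h j)%N == i))].
have hM j : (h j <= M)%N.
  rewrite (@leq_trans (size (dl j))) ?szdl -?addnn ?leq_addr // addnn -szdl.
  rewrite size_dart_list leqW // [leqRHS](bigID (fun i => j \in X i)) /=.
  exact: leq_addr.
have neq j k : (k < h j)%N -> lab j k != lab j (k + h j)%N.
  exact: opposite_dart_neq.
(* A pair contains at most one copy of [i], so as many pairs meet [i] as there are copies of [i]. *)
have cardA j i : j \in X i -> #|A j i| = p ord0 i.
  move=> ji; pose F k : nat := (lab j k == i) || (lab j (k + h j)%N == i).
  have -> : #|A j i| = (\sum_(k < h j) F k)%N.
    rewrite (big_ord_widen M F (hM j)) -sum1_card.
    under eq_bigl do rewrite inE.
    by rewrite big_mkcondr; apply: eq_bigr => s _; rewrite /F; case: ifP.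
  have -> : p ord0 i = (\sum_(0 <= k < h j + h j) (lab j k == i))%N.
    have := count_dart_list X p j i; rewrite ji mul1n => <-.
    rewrite -sum1_count (big_nth x0) szdl -addnn big_mkcond.
    by apply: eq_bigr => k _; rewrite /lab; case: eqP.
  rewrite (big_cat_nat (leq0n _) (leq_addr (h j) (h j))) /=.
  have -> : (\sum_(h j <= k < h j + h j) (lab j k == i))%N =
      (\sum_(0 <= k < h j) (lab j (k + h j)%N == i))%N.
    by rewrite -{1}[h j]add0n big_addn addnK.
  rewrite -big_split big_mkord /=.
  apply: eq_bigr => k _; rewrite /F; have ne := neq j k (ltn_ord k).
  case: (lab j k =P i) => e1; case: (lab j (k + h j)%N =P i) => e2 //.
  by rewrite e1 e2 eqxx in ne.
pose pi j i : {perm 'I_M} := sval (cid (perm_sending_initial (A j i))).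
have piE j i s : j \in X i -> (pi j i s < p ord0 i)%N = (s \in A j i).
  by move=> ji; rewrite -(cardA _ _ ji) /pi; case: cid => /= f ->.
exists M, pi, (\matrix_(i, s) (s < p ord0 i)%N%:R); split=> // [j s|i].
  have bitsE i : (i \in bits_of H j) = (j \in X i) by rewrite !inE.
  rewrite (eq_bigl _ _ bitsE).
  under eq_bigr => i ji do rewrite mxE piE //.
  rewrite -natr_sum; apply/eqP; rewrite F2_natr_eq0.
  case: (ltnP s (h j)) => sh; last first.
    by rewrite big1 // => i _; rewrite inE ltnNge sh.
  have in_X k : (k < size (dl j))%N -> j \in X (lab j k).
    move=> /(mem_nth x0); rewrite /lab; case: (nth _ _ _) => i t.
    by rewrite mem_dart_list => /andP[].
  rewrite (bigD1 (lab j s)) ?in_X ?szdl -?addnn; [|lia..].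
  rewrite (bigD1 (lab j (s + h j)%N)) /=; last first.
    by rewrite in_X ?szdl -?addnn 1?eq_sym ?neq //; lia.
  rewrite !inE sh !eqxx orbT big1 // => i /andP[/andP[_ /negbTE ne1] /negbTE ne2].
  by rewrite inE sh eq_sym ne1 eq_sym ne2.
transitivity (\sum_(s < M | (s < p ord0 i)%N) 1)%N.
  rewrite -(big_ord_widen M (fun=> 1%N)) ?sum1_card ?card_ord // leqW //.
  by rewrite (bigD1 i) //= leq_addr.
rewrite big_mkcond; apply: eq_bigr => s _; rewrite mxE.
by case: (s < _)%N.
Qed.

(** * Backtrackless tailless cycles *)

Section ZipCycle.
Variables (T : Type) (e : rel T).

Lemma path_zip x y p :
  path e x (rcons p y) = all (fun ab => e ab.1 ab.2) (zip (x :: p) (rcons p y)).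
Proof. by elim: p x => [|z p IHp] x //=; rewrite IHp. Qed.

Lemma cycle_zip s :
  cycle e s = all (fun ab => e ab.1 ab.2) (zip s (rot 1 s)).
Proof. by case: s => // x p; rewrite rot1_cons -path_zip. Qed.

Lemma nth_rot1 (x0 : T) s k : (k < size s)%N ->
  nth x0 (rot 1 s) k = nth x0 s (k.+1 %% size s).
Proof.
case: s => // x p; rewrite rot1_cons nth_rcons ltnS leq_eqVlt /= => /predU1P[->|kp].
  by rewrite ltnn eqxx modnn.
by rewrite kp modn_small.
Qed.

Lemma cycle_nthP (x0 : T) s :
  reflect (forall k, (k < size s)%N -> e (nth x0 s k) (nth x0 s (k.+1 %% size s)))
          (cycle e s).
Proof.
rewrite cycle_zip; apply: (iffP (all_nthP (x0, x0))); rewrite size_zip size_rot minnn.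
  by move=> es k ks; have := es k ks; rewrite nth_zip ?size_rot // nth_rot1.
by move=> es k ks; rewrite nth_zip ?size_rot // nth_rot1 // es.
Qed.

End ZipCycle.
Arguments cycle_nthP {T} e x0 s.

Section Cycles.
Variables (V : finType) (n : nat) (X : edge_graph V n).
Hypothesis X2 : forall i, #|X i| = 2.
Implicit Types (s : seq (V * 'I_n)) (a b c : V * 'I_n).

(* A directed edge is the pair of its origin and its index. *)
Definition step : rel (V * 'I_n) :=
  fun a b => (X a.2 == [set a.1; b.1]%SET) && (a.2 != b.2).

Definition directed_cycle : pred (seq (V * 'I_n)) :=
  fun s => (s != [::]) && cycle step s.

Definition nb_cycle (G : seq 'I_n) : Prop :=
  [/\ is_cycle X G, backtrackless G & tailless G].

(** Taillessness is the backtracking condition at the closing turn, so both together form one cyclic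
    condition. *)
Lemma backtrackless_taillessE (G : seq 'I_n) :
  backtrackless G && tailless G = cycle [rel e f | e != f] G.
Proof. by case: G => //= e G; rewrite rcons_path /= [e == _]eq_sym. Qed.

Lemma nb_cycleP (G : seq 'I_n) :
  nb_cycle G <-> exists2 s, directed_cycle s & G = map snd s.
Proof.
rewrite /nb_cycle; split=> [[isG bG tG]|[s /andP[s0 cs] ->]].
  have cG : cycle [rel e f | e != f] G by rewrite -backtrackless_taillessE bG.
  case: G isG {bG tG} cG => // e G isG cG; move: isG.
  case/andP=> _ /existsP[v /forallP vG].
  pose s := [seq (v k, tnth (in_tuple (e :: G)) k) | k <- enum 'I_(size (e :: G))].
  have ss : size s = (size G).+1 by rewrite size_map size_enum_ord.
  have nth_s k (kG : (k < (size G).+1)%N) x0 :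
      nth x0 s k = (v (Ordinal kG), nth e (e :: G) k).
    rewrite (nth_map (Ordinal kG)) ?size_enum_ord //.
    have -> : nth (Ordinal kG) (enum 'I_(size (e :: G))) k = Ordinal kG.
      by apply/val_inj; rewrite /= nth_enum_ord.
    by rewrite (tnth_nth e).
  exists s; last first.
    apply: (@eq_from_nth _ e) => [|k kG]; first by rewrite size_map ss.
    by rewrite (nth_map (v ord0, e)) ?ss // nth_s.
  rewrite /directed_cycle -size_eq0 ss /=; apply/(cycle_nthP _ (v ord0, e) _) => k.
  rewrite ss => kG; have k1G : (k.+1 %% (size G).+1 < (size G).+1)%N by rewrite ltn_mod.
  rewrite !nth_s /step /=; apply/andP; split.
    have := vG (Ordinal kG); rewrite (tnth_nth e) /=.
    by congr (_ == [set _; v _]%SET); apply/val_inj.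
  exact: elimT (cycle_nthP _ e _) cG k kG.
have [[u i] us] : exists a, a \in s by case: s s0 {cs} => // a s _; exists a; rewrite mem_head.
have cG : cycle [rel e f | e != f] (map snd s).
  by rewrite cycle_map; apply: sub_cycle cs => a b /andP[].
have /andP[-> ->] := etrans (backtrackless_taillessE _) cG; split=> //.
rewrite /is_cycle; apply/andP; split; first by case: (s) s0.
apply/existsP; exists [ffun k : 'I_(size (map snd s)) => (nth (u, i) s k).1].
apply/forallP => k; rewrite !ffunE (tnth_nth i) /= (nth_map (u, i)).
  have ks := ltn_ord k; rewrite {2}size_map in ks.
  have /andP[/eqP -> _] := elimT (cycle_nthP step (u, i) s) cs k ks.
  by rewrite -(size_map snd s).
by have := ltn_ord k; rewrite {2}size_map.
Qed.

Definition other_end (i : 'I_n) (v : V) : V :=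
  odflt v [pick w in X i | w != v].

Lemma other_endE i v : v \in X i -> X i = [set v; other_end i v]%SET.
Proof.
move=> vi; rewrite /other_end; case: pickP => [w /andP[wi wv]|none].
  apply/eqP; rewrite eq_sym eqEcard X2 cards2 eq_sym wv andbT.
  by apply/fintype.subsetP => x; rewrite !inE => /orP[] /eqP ->.
suff : (#|X i| <= 1)%N by rewrite X2.
rewrite -(cards1 v) subset_leq_card //; apply/fintype.subsetP => x xi.
by have := none x; rewrite xi inE => /negbFE.
Qed.

Lemma other_end_in i v : v \in X i -> other_end i v \in X i.
Proof. by move=> /other_endE ->; rewrite !inE eqxx orbT. Qed.

Lemma other_end_neq i v : v \in X i -> other_end i v != v.
Proof.
move=> /other_endE Xi; have := X2 i; rewrite Xi cards2 eq_sym.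
by case: eqP.
Qed.

Lemma edge_other_end i u v : X i = [set u; v]%SET -> other_end i u = v.
Proof.
move=> Xi; have ui : u \in X i by rewrite Xi !inE eqxx.
have := other_end_in ui; have := other_end_neq ui.
by rewrite Xi !inE => /negbTE -> /eqP.
Qed.

Lemma other_endK i v : v \in X i -> other_end i (other_end i v) = v.
Proof. by move=> vi; apply: edge_other_end; rewrite finset.setUC -other_endE. Qed.

(** Every passage through [v] consists of an entering and a leaving edge, which gives an even sum.
    These two edges differ, so a passage uses a given edge at most once. *)
Lemma directed_cycle_balanced s :
  directed_cycle s -> balanced X (multiplicities (map snd s)).
Proof.
case/andP=> _; rewrite cycle_zip; set z := zip _ _ => /allP stepz v.
have z1 P : count P s = count (fun x => P x.1) z.
  by rewrite -(count_map fst) -/(unzip1 z) unzip1_zip ?size_rot.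
have z2 P : count P s = count (fun x => P x.2) z.
  rewrite -(count_map snd) -/(unzip2 z) unzip2_zip ?size_rot //.
  by apply/seq.permP; rewrite perm_sym perm_rot.
have sumE : (\sum_(i | v \in X i) multiplicities (map snd s) ord0 i)%N =
    (count (fun a => a.1 == v) s).*2.
  transitivity (count (fun a => v \in X a.2) s).
    rewrite -(count_map snd (fun i => v \in X i)) -sum1_count.
    under eq_bigr do rewrite mxE -sum1_count.
    rewrite (exchange_big_dep (fun i => v \in X i)) /=; last first.
      by move=> i j vi /eqP ->.
    apply: eq_bigr => j vj; rewrite (big_pred1 j) // => i /=.
    by rewrite [RHS]eq_sym; case: eqP => [<-|]; rewrite ?vj ?andbF.
  pose P a := a.1 == v.
  rewrite -addnn (z1 (fun a => v \in X a.2)) -/P {1}(z1 P) (z2 P) {}/P; elim: (z) stepz => //= -[a b] z' IHz stepz.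
  rewrite IHz => [|x xz]; last by apply: stepz; rewrite inE xz orbT.
  have /andP[/eqP Xa _] := stepz _ (mem_head _ _); rewrite /= in Xa.
  have := X2 a.2; rewrite Xa cards2 !inE [v == _]eq_sym [v == b.1]eq_sym.
  by case: (a.1 =P v) => [->|]; case: (b.1 =P v) => [->|]; rewrite ?eqxx //=; lia.
rewrite sumE odd_double; split=> // i vi; rewrite leq_double mxE.
rewrite (count_map snd (pred1 i)) (z1 (preim snd (pred1 i))).
(* An occurrence of [i] either leaves [v], or enters [v] and is followed by an edge other than [i].
   The passages through [v] are split accordingly and read at the first or the second component of
   the pairs in [z]. *)
have -> : count (fun a => a.1 == v) s =
    (count (fun x => (x.1.1 == v) && (x.1.2 == i)) z +
     count (fun x => (x.2.1 == v) && (x.2.2 != i)) z)%N.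
  rewrite -(z1 (fun a => (a.1 == v) && (a.2 == i))).
  rewrite -(z2 (fun a => (a.1 == v) && (a.2 != i))).
  rewrite -(count_predUI) [X in (_ + X)%N](eq_count (a2 := pred0)) ?count_pred0 ?addn0.
    by apply: eq_count => a /=; case: (a.1 == v); case: (a.2 == i).
  by move=> a /=; case: (a.2 == i); rewrite ?andbF.
elim: (z) stepz => //= -[a b] z' IHz stepz /=.
have {}IHz := IHz (fun x xz => stepz x (mem_behead (s := _ :: _) xz)).
have /andP[/eqP /= Xa ab] := stepz _ (mem_head _ _); rewrite /= in ab.
move: IHz; case: (a.2 =P i) => [ai|_] /=; last by rewrite andbF; lia.
move: vi; rewrite -{1}ai Xa !inE ![v == _]eq_sym -ai [b.2 == _]eq_sym ab !andbT.
by case: (a.1 == v); case: (b.1 == v) => //= _; rewrite -?ai; lia.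
Qed.

(** * Merging cycles at a common vertex *)

Lemma cycle_visits s a u :
  cycle step s -> a \in s -> u \in X a.2 -> u \in map fst s.
Proof.
move=> cs sa; have /andP[/eqP -> _] := next_cycle cs sa.
by rewrite !inE => /orP[] /eqP ->; rewrite map_f // mem_next.
Qed.

Lemma cycle_origin s a : cycle step s -> a \in s -> a.1 \in X a.2.
Proof. by move=> cs sa; have /andP[/eqP -> _] := next_cycle cs sa; rewrite !inE eqxx. Qed.

(** Reverse the order and move every origin to the other end. The first and last edges at the
    starting vertex are exchanged, which is the information needed for splicing. *)
Lemma reverse_cycle c t : cycle step (c :: t) ->
  exists c' t', [/\ cycle step (c' :: t'), c'.1 = c.1, c'.2 = (last c t).2,
    (last c' t').2 = c.2 & perm_eq (map snd (c' :: t')) (map snd (c :: t))].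
Proof.
move=> ct; pose flip a := (other_end a.2 a.1, a.2).
have rv : rev (map flip (c :: t)) = flip (last c t) :: rev (map flip (belast c t)).
  by rewrite lastI map_rcons rev_rcons.
have st : step (last c t) c by move: ct; rewrite /= rcons_path => /andP[].
exists (flip (last c t)), (rev (map flip (belast c t))); rewrite -!rv; split=> //.
- rewrite rev_cycle cycle_map.
  apply: (@sub_in_cycle _ (mem (c :: t)) step) (ct) => [a b sa sb|]; last exact/allP.
  move=> /andP[/eqP Xa ab]; rewrite /step /= eq_sym in ab *; rewrite ab andbT.
  rewrite (edge_other_end Xa) finset.setUC -other_endE ?eqxx //.
  exact: cycle_origin ct sb.
- by apply: edge_other_end; have /andP[/eqP ->] := st.
- have -> : last (flip (last c t)) (rev (map flip (belast c t))) =
      last (flip (last c t)) (rev (map flip (c :: t))) by rewrite rv.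
  by rewrite /= rev_cons last_rcons.
by rewrite map_rev perm_rev -map_comp perm_refl.
Qed.

Lemma join_cycles a t c u : cycle step (a :: t) -> cycle step (c :: u) ->
  a.1 = c.1 -> (last a t).2 != c.2 -> (last c u).2 != a.2 ->
  cycle step ((a :: t) ++ c :: u).
Proof.
rewrite /= !rcons_path => /andP[pt /andP[/eqP Xt _]] /andP[pu /andP[/eqP Xu _]].
move=> ac tc ua; rewrite cat_path last_cat /= pt pu /step /=.
by rewrite Xt Xu ac eqxx tc eqxx ua.
Qed.

(* At a common vertex of two cycles, at least one of the two ways to insert the
   second cycle (forwards or backwards) into the first has no backtracking. *)
Lemma merge_cycles s1 s2 v : directed_cycle s1 -> directed_cycle s2 ->
  v \in map fst s1 -> v \in map fst s2 ->
  exists2 s, directed_cycle s & perm_eq (map snd s) (map snd (s1 ++ s2)).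
Proof.
move=> /andP[_ cs1] /andP[_ cs2] /mapP[a /rot_to[r1 t1 rs1] va].
move=> /mapP[c /rot_to[r2 t2 rs2] vc].
have c1 : cycle step (a :: t1) by rewrite -rs1 rot_cycle.
have c2 : cycle step (c :: t2) by rewrite -rs2 rot_cycle.
have ps1 : perm_eq (map snd (a :: t1)) (map snd s1) by rewrite perm_map // -rs1 perm_rot.
have ps2 : perm_eq (map snd (c :: t2)) (map snd s2) by rewrite perm_map // -rs2 perm_rot.
case: (boolP (((last a t1).2 != c.2) && ((last c t2).2 != a.2))) => [/andP[n1 n2]|].
  exists ((a :: t1) ++ c :: t2); first by apply: join_cycles; rewrite -?va -?vc.
  by rewrite !map_cat perm_cat.
have [c' [t' [c'C c'1 c'2 l' p']]] := reverse_cycle c2.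
have := c1; have := c2; rewrite /= !rcons_path => /andP[_ /andP[_ l2]] /andP[_ /andP[_ l1]].
move=> bad; exists ((a :: t1) ++ c' :: t'); last first.
  by rewrite !map_cat perm_cat // (perm_trans p').
(* A repeated edge at either junction of the reversed splicing would make both junctions of the
   forward splicing admissible, because neither cycle repeats an edge at its own closing turn. *)
apply: join_cycles; rewrite ?c'1 ?c'2 ?l' -?va -?vc //.
  by apply: contraNneq bad => e; rewrite -e l1 e l2.
by apply: contraNneq bad => e; rewrite e l1 -e l2.
Qed.

(** If the first cycle meets another one, merge the two and induct on the number of cycles.
    Otherwise its vertex set is closed under adjacency, since every edge lies on some cycle, and a
    vertex of a second cycle contradicts connectedness. *)
Lemma merge_connected_cycles (L : seq (seq (V * 'I_n))) :
  edge_connected X -> L != [::] -> all directed_cycle L ->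
  (forall i, i \in map snd (flatten L)) ->
  exists2 s, directed_cycle s & perm_eq (map snd s) (map snd (flatten L)).
Proof.
move=> connX; elim: {L}(size L) {-2}L (erefl (size L)) => [|k IHk] [] // s1 L [sL] _.
case: L sL => [|s2 L] sL; first by rewrite /= cats0 andbT => ? _; exists s1.
move=> cL' cover.
have {cL'} /andP[c1 cL] : directed_cycle s1 && all directed_cycle (s2 :: L) := cL'.
have [[s3 [v [L3 v1 v3]]]|none] :=
  pselect (exists s3 v, [/\ s3 \in s2 :: L, v \in map fst s1 & v \in map fst s3]).
  have c3 := allP cL _ L3; have [s4 c4 p4] := merge_cycles c1 c3 v1 v3.
  have pL : perm_eq (map snd (flatten (s4 :: rem s3 (s2 :: L))))
      (map snd (flatten (s1 :: s2 :: L))).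
    rewrite /= map_cat (perm_trans (perm_cat p4 (perm_refl _))) //.
    rewrite -map_cat perm_map //= -catA perm_cat2l.
    by rewrite perm_sym (perm_flatten (perm_to_rem L3)).
  have [||||s cs ps] := IHk (s4 :: rem s3 (s2 :: L)) => //.
  - by rewrite [size _]/= -sL (perm_size (perm_to_rem L3)).
  - by rewrite [all _ _](congr1 (andb^~ _) c4); apply/allP => s /mem_rem /(allP cL).
  - by move=> i; rewrite (perm_mem pL).
  by exists s => //; apply: perm_trans ps pL.
exfalso; pose S := map fst s1.
have inS i u v : u \in S -> u \in X i -> v \in X i -> v \in S.
  move=> uS ui vi; have /mapP[a /flattenP[s + sa] ia] := cover i.
  rewrite ia in ui vi; rewrite inE => /predU1P[ss1|sL2].
    rewrite ss1 in sa; apply: cycle_visits sa vi.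
    by case/andP: c1.
  case: none; exists s, u; split=> //; apply: cycle_visits sa ui.
  by have /andP[] := allP cL _ sL2.
have clS u v : connect (adjacent X) u v -> (u \in S) = (v \in S).
  apply: (@closed_connect _ _ (mem S)) => {}u {}v /existsP[i /eqP Xi].
  by apply/idP/idP => uS; apply: (inS i _ _ uS); rewrite Xi !inE eqxx ?orbT.
have mem1 s : directed_cycle s -> exists2 a, a \in s & a.1 \in X a.2.
  case: s => // a s /andP[_ cs]; exists a; first exact: mem_head.
  exact: cycle_origin cs (mem_head _ _).
have [a sa Xa] := mem1 _ c1.
have [b sb Xb] := mem1 s2 (allP cL _ (mem_head _ _)).
apply: none; exists s2, b.1; split; [exact: mem_head | | exact: map_f].
by rewrite -/S -(clS _ _ (connX _ _ _ _ Xa Xb)) map_f.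
Qed.

End Cycles.

(** * Decomposition into cycles *)

(* The orbits of [tau \o sigma] come in pairs exchanged by [sigma], and no orbit
   is its own mirror image: an orbit containing both [x] and [sigma x] would
   contain a fixed point of [sigma] or [tau]. *)
Lemma involution_orbits (T : finType) (sigma tau : T -> T) (D : {set T}) :
  involutive sigma -> involutive tau ->
  {in D, forall x, [/\ sigma x \in D, tau x \in D, sigma x != x & tau x != x]} ->
  exists L : seq (seq T),
    all (fun O => (O != [::]) && fcycle (tau \o sigma) O) L /\
    perm_eq (flatten L ++ map sigma (flatten L)) (enum D).
Proof.
move=> sK tK; pose phi := tau \o sigma.
have phi_inj : injective phi by move=> x y /(inv_inj tK)/(inv_inj sK).
elim: {D}#|D| {-2}D (leqnn #|D|) => [|k IHk] D.
  rewrite leqn0 cards_eq0 => /eqP -> _; exists [::]; split=> //=.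
  by rewrite enum_set0.
move=> Dk closD; case: (set_0Vmem D) => [->|[d dD]].
  by exists [::]; split=> //=; rewrite enum_set0.
pose O := fingraph.orbit phi d.
have OD : {subset O <= D}.
  move=> x; rewrite -fconnect_orbit => /iter_findex <-.
  elim: (findex _ _ _) => //= i; rewrite /phi /= => /closD[sD _ _ _].
  by have [] := closD _ sD.
(* Descent by two: [sigma x = phi^(i+2) x] implies [sigma (phi x) = phi^i (phi x)]. The exponents 0
   and 1 give fixed points of [sigma] and of [tau]. *)
have mirror x i : x \in D -> sigma x != iter i phi x.
  have [l] := ubnP i; elim: l i x => // l IHl [|[|i]] x il xD.
  - by have [] := closD x xD.
  - apply/eqP; rewrite /= /phi /= => e.
    have [sD _ _ _] := closD x xD; have [_ _ _] := closD _ sD.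
    by rewrite -e eqxx.
  apply/eqP => e; have [sD _ _ _] := closD x xD.
  have [_ tsD _ _] := closD _ sD.
  have /eqP[] := IHl i (phi x) (ltnW il) tsD.
  by apply: phi_inj; rewrite -iterS -iterSr -e /phi /= sK tK.
have sO x : x \in O -> sigma x \notin O.
  move=> xO; apply/negP; rewrite -fconnect_orbit => sx.
  have : fconnect phi x (sigma x).
    by apply: connect_trans sx; rewrite fconnect_sym // fconnect_orbit.
  by move=> /iter_findex/esym/eqP; apply/negP/mirror/OD.
pose D' := D :\: [set x | (x \in O) || (sigma x \in O)]%SET.
have inD' x : (x \in D') = [&& x \in D, x \notin O & sigma x \notin O].
  by rewrite !inE negb_or andbC.
have [||L [cL pL]] := IHk D'.
- rewrite -ltnS (leq_trans _ Dk) // proper_card //; apply/properP; split.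
    by apply/fintype.subsetP => x; rewrite inD' => /and3P[].
  by exists d => //; rewrite inD' dD fingraph.in_orbit.
- move=> x; rewrite inD' => /and3P[xD xO sxO]; have [sD tD sx tx] := closD x xD.
  split=> //; rewrite inD' ?sD ?tD ?sxO ?sK ?xO //=; apply/andP; split.
    apply: contra sxO; rewrite -!fconnect_orbit => dt; apply: connect_trans dt _.
    by rewrite fconnect_sym // -[tau x](_ : phi (sigma x) = _) ?fconnect1 ///phi /= sK.
  by apply: contra xO => /fingraph.mem_orbit; rewrite /phi /= sK tK.
have sOD x : x \in O -> sigma x \in D by move=> /OD /closD[].
exists (O :: L); split.
  rewrite /= cL andbT cycle_orbit // andbT.
  by have := fingraph.in_orbit phi d; rewrite -/O; case: (O).
rewrite /= map_cat perm_catACA (perm_trans (perm_cat (perm_refl _) pL)) //.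
apply: uniq_perm; rewrite ?enum_uniq // ?cat_uniq.
  rewrite orbit_uniq map_inj_uniq ?orbit_uniq ?enum_uniq; last exact: inv_inj.
  rewrite !andbT /=; apply/andP; split.
    apply/hasPn => _ /mapP[x xO ->]; exact: sO.
  apply/hasPn => x; rewrite mem_enum inD' mem_cat => /and3P[_ /negbTE -> sxO].
  by apply: contra sxO => /mapP[y yO ->]; rewrite sK.
move=> x; rewrite !mem_cat !mem_enum inD'; case: (boolP (x \in O)) => xO.
  by rewrite OD.
have -> : (x \in map sigma O) = (sigma x \in O).
  by rewrite -{1}(sK x) mem_map //; exact: inv_inj.
by case: (boolP (sigma x \in O)) => sxO; rewrite ?andbT //=; rewrite -(sK x) sOD.
Qed.

(** * The pairing as an involution, and the cycles it traces *)

Definition opposite_index (k h : nat) : nat :=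
  if (k < h)%N then (k + h)%N else (k - h)%N.

Lemma ltn_opposite_index k h : (k < h.*2)%N -> (opposite_index k h < h.*2)%N.
Proof. by rewrite /opposite_index; case: (ltnP k h); lia. Qed.

Lemma opposite_indexK k h : (k < h.*2)%N ->
  opposite_index (opposite_index k h) h = k.
Proof.
rewrite /opposite_index; case: (ltnP k h) => kh; first by case: (ltnP (k + h) h); lia.
by case: (ltnP (k - h) h); lia.
Qed.

Section Decomposition.
Variables (V : finType) (n : nat) (X : edge_graph V n) (p : 'rV[nat]_n).
Hypothesis X2 : forall i, #|X i| = 2.
Hypothesis balp : balanced X p.

Let h v := half_degree X p v.
Let dl v := dart_list X p v.

Definition opposite_dart (v : V) (x : 'I_n * nat) : 'I_n * nat :=
  nth x (dl v) (opposite_index (index x (dl v)) (h v)).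

Lemma opposite_dartP v x : x \in dl v ->
  [/\ opposite_dart v x \in dl v, opposite_dart v (opposite_dart v x) = x
    & (opposite_dart v x).1 != x.1].
Proof.
move=> xv; have sz := size_dart_list_half balp v; rewrite -/(dl v) -/(h v) in sz.
have xs : (index x (dl v) < (h v).*2)%N by rewrite -sz index_mem.
rewrite /opposite_dart; set k := index x (dl v) in xs *.
have os : (opposite_index k (h v) < (h v).*2)%N.
  exact: ltn_opposite_index.
have idx y : index (nth y (dl v) (opposite_index k (h v))) (dl v) =
    opposite_index k (h v).
  by rewrite index_uniq ?sz // dart_list_uniq.
have xE y : nth y (dl v) k = x by rewrite (set_nth_default x) ?nth_index ?sz.
split; first by rewrite mem_nth ?sz.
  rewrite idx -[RHS](xE (nth x (dl v) (opposite_index k (h v)))); congr nth.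
  exact: opposite_indexK.
rewrite -{2}(xE x) /opposite_index; case: (ltnP k) => kh.
  by rewrite eq_sym opposite_dart_neq.
have := @opposite_dart_neq _ _ _ _ balp x v (k - h v).
by rewrite subnK //; apply; rewrite -/(h v); lia.
Qed.

(** On directed copies of edges, [sigma] moves to the other end of the copy and [tau] to the copy
    paired with it at the same vertex. Iterating [tau \o sigma] traces cycles without backtracking,
    and one orbit out of each mirror pair traverses every copy once. *)
Lemma balanced_sum_cycles : exists L : seq (seq (V * 'I_n)),
  all (directed_cycle X) L /\
  forall i, count_mem i (map snd (flatten L)) = p ord0 i.
Proof.
(* The bound [K] makes the type of directed copies finite; [sigma] and [tau] are the identity
   outside [D], so that they are involutions on all of [T]. *)
pose K := (\sum_i p ord0 i)%N.
have pK i : (p ord0 i <= K)%N by rewrite /K (bigD1 i) //= leq_addr.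
pose T : finType := (V * ('I_n * 'I_K.+1))%type.
pose D : {set T} := [set d : T | (d.1 \in X d.2.1) && (d.2.2 < p ord0 d.2.1)%N]%SET.
pose sigma (d : T) : T := if d \in D then (other_end X d.2.1 d.1, d.2) else d.
pose dart (d : T) : 'I_n * nat := (d.2.1, val d.2.2).
pose tau (d : T) : T :=
  if d \in D then let x := opposite_dart d.1 (dart d) in (d.1, (x.1, inord x.2))
  else d.
have dartD (d : T) : (dart d \in dl d.1) = (d \in D) by rewrite mem_dart_list inE.
have sE d : d \in D -> sigma d = (other_end X d.2.1 d.1, d.2).
  by rewrite /sigma => ->.
have sD d : d \in D -> sigma d \in D.
  by move=> dD; rewrite sE //; move: dD; rewrite !inE => /andP[/(other_end_in X2) ->].
have dart_tau d : d \in D -> dart (tau d) = opposite_dart d.1 (dart d).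
  move=> dD; have [+ _ _] := opposite_dartP (etrans (dartD d) dD).
  rewrite /tau dD /dart /=; case: (opposite_dart _ _) => i t /=.
  rewrite mem_dart_list => /andP[_ tp]; rewrite inordK //.
  exact: leq_trans (leq_trans tp (pK i)) (leqnSn K).
have tau1 d : (tau d).1 = d.1 by rewrite /tau; case: ifP.
have tD d : d \in D -> tau d \in D.
  move=> dD; rewrite -dartD dart_tau // tau1.
  by have [] := opposite_dartP (etrans (dartD d) dD).
have dart_inj d d' : d.1 = d'.1 -> dart d = dart d' -> d = d'.
  by case: d d' => [v [i t]] [v' [i' t']] /= -> [-> /val_inj ->].
have sK : involutive sigma.
  move=> d; case: (boolP (d \in D)) => dD; last by rewrite /sigma !(negbTE dD).
  rewrite (sE _ (sD _ dD)) sE //= other_endK -?surjective_pairing //.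
  by move: dD; rewrite inE => /andP[].
have tK : involutive tau.
  move=> d; case: (boolP (d \in D)) => dD; last by rewrite /tau !(negbTE dD).
  apply: dart_inj; rewrite ?tau1 // !dart_tau ?tD // tau1.
  by have [_ ->] := opposite_dartP (etrans (dartD d) dD).
have lab_tau d : d \in D -> (tau d).2.1 != d.2.1.
  move=> dD; have := dart_tau d dD => /(congr1 fst) /= ->.
  by have [_ _] := opposite_dartP (etrans (dartD d) dD).
have [|L [cL pL]] := involution_orbits sK tK (D := D).
  move=> d dD; split; rewrite ?sD ?tD //.
    rewrite sE // -pair_eqE /= negb_and other_end_neq //.
    by move: dD; rewrite inE => /andP[].
  by apply: contraNneq (lab_tau d dD) => ->.
have memL d : d \in flatten L -> d \in D.
  by move=> dL; rewrite -mem_enum -(perm_mem pL) mem_cat dL.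
pose strip (d : T) := (d.1, d.2.1).
exists (map (map strip) L); split.
  apply/allP => _ /mapP[O OL ->]; have /andP[O0 cO] := allP cL O OL.
  rewrite /directed_cycle -size_eq0 size_map size_eq0 O0 cycle_map /=.
  apply: (@sub_in_cycle _ (mem D) (frel (tau \o sigma))) cO; last first.
    by apply/allP => d dO; apply/memL/flattenP; exists O.
  move=> d _ dD _ /eqP <-; rewrite /step /= tau1.
  have := lab_tau _ (sD d dD); rewrite eq_sym sE //= => ->.
  rewrite andbT -other_endE //.
  by move: dD; rewrite inE => /andP[].
(* [sigma] preserves edge labels, so [L] carries exactly half of the [2 p i] directed copies of [i]
   in [D]. *)
move=> i; apply: double_inj.
pose P (d : T) := d.2.1 == i.
have -> : count_mem i (map snd (flatten (map (map strip) L))) = count P (flatten L).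
  by rewrite -map_flatten -map_comp count_map.
have := seq.permP pL P; rewrite count_cat count_map.
rewrite (@eq_in_count _ (preim sigma P) P) => [|d /memL dD]; last by rewrite /P /= sE.
rewrite addnn => ->; rewrite -sum1_count big_enum_cond sum1_card.
transitivity #|(finset.setX (X i) (finset.setX [set i]
      [set t : 'I_K.+1 | (t < p ord0 i)%N]))%SET|.
  apply: eq_card => -[v [i' t]]; rewrite unfold_in !inE /P /=.
  by case: (i' =P i) => [->|_]; rewrite ?andbT ?andbF.
rewrite !cardsX X2 cards1 mul1n mul2n; congr _.*2.
rewrite -sum1_card; under eq_bigl do rewrite inE.
by rewrite -(big_ord_widen K.+1 (fun=> 1%N)) ?sum1_card ?card_ord // leqW.
Qed.

End Decomposition.

(** * Support of the zeta function *)

Lemma balanced0 (V : finType) (n : nat) (X : edge_graph V n) : balanced X 0.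
Proof.
move=> v; under eq_bigr do rewrite mxE.
by rewrite sum_nat_const muln0; split=> // i _; rewrite mxE.
Qed.

Lemma balancedD (V : finType) (n : nat) (X : edge_graph V n) (p q : 'rV[nat]_n) :
  balanced X p -> balanced X q -> balanced X (p + q).
Proof.
move=> bp bq v; under eq_bigr do rewrite mxE.
rewrite big_split oddD (negbTE (bp v).1) (negbTE (bq v).1); split=> // i vi.
by rewrite mxE doubleD leq_add ?(bp v).2 ?(bq v).2.
Qed.

(** * Power series with nonnegative coefficients *)

Section Supports.
Variable n : nat.
Implicit Types (f g : pseries n) (d e : 'rV[nat]_n).

Definition nonneg_pseries f : Prop := forall d, 0 <= f d.

Lemma ps_mul_ge0 f g :
  nonneg_pseries f -> nonneg_pseries g -> nonneg_pseries (ps_mul f g).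
Proof. by move=> f0 g0 d; apply: sumr_ge0 => ab _; rewrite mulr_ge0. Qed.

(** Nonnegative terms cannot cancel, so a single nonzero term decides. *)
Lemma ps_mul_neq0P f g d : nonneg_pseries f -> nonneg_pseries g ->
  ps_mul f g d != 0 <-> exists a b, [/\ a + b = d, f a != 0 & g b != 0].
Proof.
move=> f0 g0; have fg0 (ab : 'rV['I_(degree d).+1]_n * 'rV['I_(degree d).+1]_n) :
    0 <= f (nat_row ab.1) * g (nat_row ab.2) :> int.
  by move: ab => [a b]; rewrite mulr_ge0.
split.
  rewrite /ps_mul psumr_neq0 // => /hasP[[a b] _ /= /andP[/eqP abd]].
  by rewrite lt0r mulf_eq0 negb_or => /andP[/andP[fa gb] _]; exists (nat_row a), (nat_row b).
move=> [a [b [abd fa gb]]].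
pose lift (c : 'rV[nat]_n) : 'rV['I_(degree d).+1]_n := \row_i inord (c ord0 i).
have liftK (c : 'rV[nat]_n) : (forall i, (c ord0 i <= d ord0 i)%N) -> nat_row (lift c) = c.
  move=> cd; apply/rowP => i; rewrite !mxE inordK // ltnS.
  exact: leq_trans (cd i) (leq_coef_degree d i).
have la : nat_row (lift a) = a by apply: liftK => i; rewrite -abd mxE leq_addr.
have lb : nat_row (lift b) = b by apply: liftK => i; rewrite -abd mxE leq_addl.
rewrite /ps_mul psumr_neq0 //; apply/hasP; exists (lift a, lift b).
  by rewrite mem_index_enum.
by rewrite /= la lb abd eqxx lt0r mulf_eq0 negb_or fa gb mulr_ge0.
Qed.

(** This class contains the geometric series of nonzero exponents and is stable under products, so
    it passes to the truncated products and to the zeta function. *)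
Definition monoid_support f : Prop :=
  [/\ nonneg_pseries f, f 0 != 0
    & forall a b, f a != 0 -> f b != 0 -> f (a + b) != 0].

Lemma ps_one_neq0 d : (ps_one n d != 0) = (d == 0).
Proof. by rewrite /ps_one /ps_monomial; case: (d == 0). Qed.

Lemma monoid_support_one : monoid_support (ps_one n).
Proof.
split=> [d||a b]; rewrite ?ps_one_neq0 //.
by move=> /eqP -> /eqP ->; rewrite addr0.
Qed.

Lemma monoid_support_mul f g :
  monoid_support f -> monoid_support g -> monoid_support (ps_mul f g).
Proof.
move=> [f_ge0 f0 fD] [g_ge0 g0 gD]; split; first exact: ps_mul_ge0.
  by apply/ps_mul_neq0P => //; exists 0, 0; rewrite addr0.
move=> c c' /(ps_mul_neq0P _ f_ge0 g_ge0)[a [b [<- fa gb]]].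
move=> /(ps_mul_neq0P _ f_ge0 g_ge0)[a' [b' [<- fa' gb']]].
by apply/ps_mul_neq0P => //; exists (a + a'), (b + b'); rewrite addrACA fD // gD.
Qed.

Lemma monoid_support_big (I : Type) (s : seq I) (P : pred I) (F : I -> pseries n) :
  (forall i, P i -> monoid_support (F i)) ->
  monoid_support (\big[@ps_mul n/ps_one n]_(i <- s | P i) F i).
Proof.
move=> mF; apply: big_ind => //; first exact: monoid_support_one.
exact: monoid_support_mul.
Qed.

(** The other factors have nonzero constant coefficient, so exponent 0 can be chosen in each of
    them. *)
Lemma ps_big_neq0 (I : eqType) (s : seq I) (P : pred I) (F : I -> pseries n) i d :
  (forall i, P i -> monoid_support (F i)) -> i \in s -> P i -> F i d != 0 ->
  (\big[@ps_mul n/ps_one n]_(i <- s | P i) F i) d != 0.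
Proof.
move=> mF + Pi Fd; elim: s => // j s IHs; rewrite inE big_cons.
have [ms1 ms2 ms3] := monoid_support_big s mF.
case: ifPn => [Pj|/negP Pj]; last first.
  by move=> /predU1P[ij|/IHs //]; case: Pj; rewrite -ij.
have [mj1 mj2 mj3] := mF j Pj.
move=> is_; apply/ps_mul_neq0P => //; case/predU1P: is_ => [<-|/IHs si].
  by exists d, 0; rewrite addr0.
by exists 0, d; rewrite add0r.
Qed.

Lemma ps_pow_monomial e k d :
  0 <= ps_pow (ps_monomial e) k d /\ (ps_pow (ps_monomial e) k d != 0) = (d == e *+ k).
Proof.
have m_ge0 : nonneg_pseries (ps_monomial e) by move=> a; rewrite /ps_monomial; case: (a == e).
have m_neq0 a : (ps_monomial e a != 0) = (a == e).
  by rewrite /ps_monomial; case: (a == e).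
elim: k d => [|k IHk] d.
  by have [p0 _ _] := monoid_support_one; rewrite ps_one_neq0.
rewrite /ps_pow iterS -/(ps_pow _ k).
have p_ge0 : nonneg_pseries (ps_pow (ps_monomial e) k) by move=> a; exact: (IHk a).1.
split; first exact: ps_mul_ge0.
apply/idP/eqP => [/(ps_mul_neq0P _ m_ge0 p_ge0)[a [b [<-]]]|->].
  by rewrite m_neq0 (IHk b).2 mulrS => /eqP -> /eqP ->.
by apply/ps_mul_neq0P => //; exists e, (e *+ k); rewrite mulrS m_neq0 (IHk _).2.
Qed.

Definition geometric e : pseries n := ps_inv (ps_sub (ps_one n) (ps_monomial e)).

Lemma geometric_ge0 e : nonneg_pseries (geometric e).
Proof.
move=> d; apply: sumr_ge0 => k _.
rewrite (_ : ps_sub _ _ = ps_monomial e) ?(ps_pow_monomial _ _ _).1 //.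
by apply/funext => a; rewrite /ps_sub subKr.
Qed.

Lemma geometric_neq0P e d : e != 0 ->
  geometric e d != 0 <-> exists k, d = e *+ k.
Proof.
move=> e0; rewrite /geometric /ps_inv.
rewrite (_ : ps_sub _ (ps_sub _ _) = ps_monomial e); last first.
  by apply/funext => a; rewrite /ps_sub subKr.
have p_ge0 (k : 'I_(degree d).+1) : true -> 0 <= ps_pow (ps_monomial e) k d.
  by rewrite (ps_pow_monomial _ _ _).1.
rewrite psumr_neq0 //; split=> [/hasP[k _]|[k dk]].
  by rewrite /= lt0r (ps_pow_monomial _ _ _).2 => /andP[/eqP dk _]; exists k.
(* [ps_inv] sums powers up to [degree d] only; this reaches [k], because [e] has positive degree and
   [degree d] is [k] times that degree. *)
have kd : (k < (degree d).+1)%N.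
  have deg_e : (0 < degree e)%N by rewrite lt0n degree_eq0.
  rewrite ltnS dk; elim: (k) => // l IHl; rewrite mulrS degreeD -add1n.
  exact: leq_add.
apply/hasP; exists (Ordinal kd); first by rewrite mem_index_enum.
have := ps_pow_monomial e k d => -[p0 pn0].
by rewrite /= lt0r p0 pn0 dk eqxx.
Qed.

Lemma monoid_support_geometric e : e != 0 -> monoid_support (geometric e).
Proof.
move=> e0; split; first exact: geometric_ge0.
  by apply/geometric_neq0P => //; exists 0%N.
move=> a b /(geometric_neq0P _ e0)[k ->] /(geometric_neq0P _ e0)[l ->].
by apply/geometric_neq0P => //; exists (k + l)%N; rewrite mulrnDr.
Qed.

Lemma multiplicities_cat (G G' : seq 'I_n) :
  multiplicities (G ++ G') = multiplicities G + multiplicities G'.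
Proof. by apply/rowP => i; rewrite !mxE count_cat. Qed.

Lemma multiplicities_flatten_nseq r (G : seq 'I_n) :
  multiplicities (flatten (nseq r G)) = multiplicities G *+ r.
Proof.
elim: r => [|r IHr]; first by apply/rowP => i; rewrite !mxE.
by rewrite /= multiplicities_cat IHr mulrS.
Qed.

Lemma eq_multiplicities (G G' : seq 'I_n) :
  perm_eq G G' -> multiplicities G = multiplicities G'.
Proof. by move=> /seq.permP GG'; apply/rowP => i; rewrite !mxE GG'. Qed.

End Supports.

(** * Support of the product over prime cycles *)

Section ZetaSupport.
Variables (V : finType) (n : nat) (X : edge_graph V n).
Hypothesis X2 : forall i, #|X i| = 2.

Lemma prime_cycle_nb k (G : k.-tuple 'I_n) :
  G \in prime_cycles X k -> nb_cycle X G /\ multiplicities G != 0.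
Proof.
rewrite inE => /asboolP[cG bG tG _]; split=> //.
rewrite -degree_eq0 degree_multiplicities size_eq0.
by case/andP: cG.
Qed.

Lemma prime_representative_nb k (G : k.-tuple 'I_n) :
  G \in prime_representatives X k -> nb_cycle X G /\ multiplicities G != 0.
Proof.
move=> GR; apply: prime_cycle_nb.
exact: (fintype.subsetP (transversal_sub (transversalP (prime_classes_partition X k)))).
Qed.

Lemma nb_cycle_balanced G : nb_cycle X G -> balanced X (multiplicities G).
Proof. by move=> /(nb_cycleP _ _)[s cs ->]; exact: directed_cycle_balanced. Qed.

Lemma zeta_factor_monoid k : monoid_support (zeta_factor X k).
Proof.
apply: monoid_support_big => G /prime_representative_nb[_ G0].
exact: monoid_support_geometric.
Qed.

Lemma zeta_upto_monoid L : monoid_support (zeta_upto X L).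
Proof. by apply: monoid_support_big => k _; exact: zeta_factor_monoid. Qed.

Lemma edge_zeta_monoid : monoid_support (edge_zeta X).
Proof.
split=> [d||a b za zb].
- by have [z0 _ _] := zeta_upto_monoid (degree d); exact: z0.
- by have [_ z0 _] := zeta_upto_monoid (degree (0 : 'rV[nat]_n)).
have [_ _ zD] := zeta_upto_monoid (degree (a + b)).
rewrite /edge_zeta zD // zeta_upto_stable // degreeD ?leq_addr ?leq_addl //.
Qed.

Lemma edge_zeta_balanced p : edge_zeta X p != 0 -> balanced X p.
Proof.
pose B (f : pseries n) := nonneg_pseries f /\ forall d, f d != 0 -> balanced X d.
have B1 : B (ps_one n).
  split=> [|d]; first by have [] := monoid_support_one n.
  by rewrite ps_one_neq0 => /eqP ->; exact: balanced0.
have BM f g : B f -> B g -> B (ps_mul f g).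
  move=> [f0 Bf] [g0 Bg]; split; first exact: ps_mul_ge0.
  move=> c /(ps_mul_neq0P _ f0 g0)[a [b [<- fa gb]]].
  by apply: balancedD; [exact: Bf | exact: Bg].
suff [_ Bz] : B (zeta_upto X (degree p)) by exact: Bz.
apply: big_ind => // k _; apply: big_ind => // G /prime_representative_nb[cG G0].
split=> [|d /(geometric_neq0P _ G0)[l ->]]; first exact: geometric_ge0.
elim: l => [|l IHl]; first exact: balanced0.
by rewrite mulrS; apply: balancedD IHl; exact: nb_cycle_balanced.
Qed.

Lemma edge_zetaMn d r : edge_zeta X d != 0 -> edge_zeta X (d *+ r) != 0.
Proof.
have [_ z0 zD] := edge_zeta_monoid => zd.
by elim: r => [|r IHr] //; rewrite mulrS zD.
Qed.

(** The representative of the class of [G] is a rotation of [G], hence has the same multiplicities.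
    Take the first power in its geometric factor and exponent 0 in all others. *)
Lemma edge_zeta_prime k (G : k.-tuple 'I_n) :
  G \in prime_cycles X k -> edge_zeta X (multiplicities G) != 0.
Proof.
move=> GP; have partX := prime_classes_partition X k.
have tr := transversalP partX.
have Gblock : finset.pblock (prime_classes X k) G \in prime_classes X k.
  by rewrite finset.pblock_mem // (finset.cover_partition partX).
set G' := transversal_repr G (prime_representatives X k) (finset.pblock (prime_classes X k) G).
have G'R : G' \in prime_representatives X k := repr_mem_transversal tr G Gblock.
have G'G : G' \in finset.pblock (prime_classes X k) G := repr_mem_pblock tr G Gblock.
have G'P : G' \in prime_cycles X k := fintype.subsetP (transversal_sub tr) _ G'R.
have [_ G'0] := prime_representative_nb G'R.
have -> : multiplicities G = multiplicities G'.
  have : cyclic_shift G G'.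
    rewrite -(@finset.pblock_equivalence_partition _ (@cyclic_shift n k) (prime_cycles X k)) //.
    by move=> *; exact: cyclic_shift_equiv.
  by case/existsP=> r /eqP ->; apply: eq_multiplicities; rewrite perm_sym perm_rot.
rewrite /edge_zeta degree_multiplicities size_tuple.
apply: (ps_big_neq0 (i := k)) => // [l _||]; first exact: zeta_factor_monoid.
  by rewrite mem_index_iota ltnSn.
apply: (ps_big_neq0 (i := G')) => //.
  move=> F /prime_representative_nb[_ F0]; exact: monoid_support_geometric.
by apply/geometric_neq0P => //; exists 1%N; rewrite mulr1n.
Qed.

(** With at least two copies of [T], the turn from the end of [T] back to its start occurs inside
    the power. *)
Lemma nb_root (T : seq 'I_n) r :
  is_cycle X T -> (2 <= r)%N -> nb_cycle X (flatten (nseq r T)) -> nb_cycle X T.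
Proof.
case: r => [|[|r]] // cT _ [_ bG tG].
have: cycle [rel e f | e != f] (flatten (nseq r.+2 T)).
  by rewrite -backtrackless_taillessE bG.
suff: cycle [rel e f | e != f] (flatten (nseq r.+2 T)) -> cycle [rel e f | e != f] T.
  by move=> + c => /(_ c); rewrite -backtrackless_taillessE => /andP[bT tT]; split.
case: T {cT bG tG} => // x t; rewrite /= !rcons_path.
by rewrite !cat_path /= => /andP[/and3P[-> -> _] _].
Qed.

(** A cycle that is not primitive is a proper power of a shorter one, so induction on the length
    applies and the exponent vector is multiplied by [r]. *)
Lemma edge_zeta_nb_cycle G : nb_cycle X G -> edge_zeta X (multiplicities G) != 0.
Proof.
elim: {G}(size G) {-2}G (leqnn (size G)) => [|k IHk] G Gk nbG.
  by have [/andP[/negP[]]] := nbG; rewrite -size_eq0 -leqn0.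
case: (pselect (primitive X G)) => [pG|/contrapT[T [r [cT r2 GE]]]].
  apply: (@edge_zeta_prime _ (in_tuple G)); rewrite inE; apply/asboolP.
  by have [? ? ?] := nbG.
rewrite GE multiplicities_flatten_nseq edge_zetaMn // IHk //; last first.
  by rewrite GE in nbG; exact: nb_root nbG.
have T0 : (0 < size T)%N by rewrite lt0n size_eq0; case/andP: cT.
have : (size T * r <= k.+1)%N.
  by rewrite (leq_trans _ Gk) // GE size_flatten /shape map_nseq sumn_nseq leqnn.
by move=> Tr; rewrite -ltnS (leq_trans _ Tr) // ltn_Pmulr.
Qed.

Lemma sum_cycles_edge_zeta (L : seq (seq (V * 'I_n))) : all (directed_cycle X) L ->
  edge_zeta X (multiplicities (map snd (flatten L))) != 0.
Proof.
have [_ z0 zD] := edge_zeta_monoid.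
elim: L => [|s L IHL] /=.
  by move=> _; rewrite (_ : multiplicities _ = 0) //; apply/rowP => i; rewrite !mxE.
case/andP=> cs /IHL zL; rewrite map_cat multiplicities_cat zD //.
by apply/edge_zeta_nb_cycle/nb_cycleP; exists s.
Qed.

Lemma edge_zeta_neq0P p : edge_zeta X p != 0 <-> balanced X p.
Proof.
split=> [|bp]; first exact: edge_zeta_balanced.
have [L [cL LE]] := balanced_sum_cycles X2 bp.
rewrite (_ : p = multiplicities (map snd (flatten L))) ?sum_cycles_edge_zeta //.
by apply/rowP => i; rewrite mxE LE.
Qed.

End ZetaSupport.

(** * Rational points of cones *)

Section ConvexCombinations.
Variables (R : realType) (n : nat).
Implicit Types (x y w : 'rV[R]_n) (Y : set 'rV[R]_n).

Lemma convex_set_combination Y x y t : convex_set Y -> Y x -> Y y ->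
  0 <= t -> t <= 1 -> Y (t *: x + (1 - t) *: y).
Proof.
move=> cY Yx Yy t0 t1.
have := cY x y (Itv01 t0 t1); rewrite !inE => /(_ Yx Yy).
exact.
Qed.

Lemma combination_convex_set Y :
  (forall x y t, Y x -> Y y -> 0 <= t -> t <= 1 -> Y (t *: x + (1 - t) *: y)) ->
  convex_set Y.
Proof.
move=> cY x y l; rewrite !inE => Yx Yy; apply: cY => //.
Qed.

End ConvexCombinations.

(* The constraints that are tight at [w] cut out a rational subspace containing
   [w]; in rational coordinates on it, every point of a small box around [w]
   satisfies the other constraints, and [w] is a convex combination of rational
   points of that box. *)
Lemma convex_hull_rational_points (R : realType) (n q : nat) (C : 'M[rat]_(n, q))
    (Y : set 'rV[R]_n) (w : 'rV[R]_n) :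
  convex_set Y ->
  (forall u : 'rV[rat]_n, (forall k, 0 <= (u *m C) 0 k) -> Y (map_mx ratr u)) ->
  (forall k, 0 <= (w *m map_mx ratr C) 0 k) -> Y w.
Proof.
move=> cY YQ wC; pose r := map_mx (@ratr R).
pose tight k := (w *m r _ _ C) 0 k == 0.
(* The columns of slack constraints are zeroed, so the rows of [B] span the rational vectors on
   which all constraints tight at [w] vanish. Kernels commute with field extension, which gives [w]
   real coordinates [x] with respect to these rows. *)
pose A : 'M[rat]_(n, q) := \matrix_(i, k) if tight k then C i k else 0.
pose B := kermx A.
have wA : w *m r _ _ A = 0.
  apply/rowP => k; rewrite [RHS]mxE; case: (boolP (tight k)) => tk.
    rewrite -[RHS](eqP tk) !mxE; apply: eq_bigr => i _.
    by rewrite !mxE tk.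
  by rewrite mxE big1 // => i _; rewrite !mxE (negbTE tk) rmorph0 mulr0.
have [x wE] : exists x : 'rV[R]_n, w = x *m r _ _ B.
  by apply/submxP; rewrite /r map_kermx; apply/sub_kermxP.
have tightB (u : 'rV[rat]_n) k : tight k -> (u *m B *m C) 0 k = 0.
  move=> tk; transitivity ((u *m B *m A) 0 k).
    by rewrite [LHS]mxE [RHS]mxE; apply: eq_bigr => i _; rewrite [A _ _]mxE tk.
  by rewrite -mulmxA mulmx_ker mulmx0 mxE.
pose phi k (y : 'rV[R]_n) := (y *m r _ _ B *m r _ _ C) 0 k.
have phiB k (y z : 'rV[R]_n) (eps : R) : (forall i, `|z 0 i - y 0 i| <= eps) ->
    phi k z - phi k y <= eps * \sum_i `|(r _ _ B *m r _ _ C) i k|.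
  move=> yz; rewrite /phi -!mulmxA !mxE -sumrB mulr_sumr; apply: ler_sum => i _.
  rewrite -mulrBl; apply: le_trans (ler_norm _) _.
  by rewrite normrM ler_wpM2r.
have [eps eps0 epsP] : exists2 eps : R, 0 < eps & forall y : 'rV[R]_n,
    (forall i, `|x 0 i - y 0 i| <= eps) -> forall k, ~~ tight k -> 0 < phi k y.
  pose M k := 1 + \sum_i `|(r _ _ B *m r _ _ C) i k|.
  have M0 k : 0 < M k by rewrite ltr_pwDl // sumr_ge0.
  pose eps : R := \big[Order.min/1]_(k | ~~ tight k) (phi k x / M k).
  have phix k : ~~ tight k -> 0 < phi k x.
    by move=> tk; rewrite lt0r /phi -wE wC andbT.
  have eps0 : 0 < eps.
    by apply/bigmin_gtP; split=> // k tk; rewrite divr_gt0 // phix.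
  exists eps => // y xy k tk.
  have epsk : eps * M k <= phi k x.
    by rewrite -ler_pdivlMr // /eps; apply: bigmin_le_cond.
  have := phiB k y x eps xy; rewrite lerBlDr -lerBlDl; apply: lt_le_trans.
  by rewrite subr_gt0 (lt_le_trans _ epsk) // ltr_pM2l // /M ltrDr.
(* Induction on the number [l] of leading coordinates that may be irrational: the last of them is
   moved to rational values below and above it inside the box, and [y] is a convex combination of
   the two resulting points. *)
have claim l (y : 'rV[R]_n) : (forall i, `|x 0 i - y 0 i| < eps) ->
    (forall i : 'I_n, (l <= i)%N -> exists u, y 0 i = ratr u) -> Y (y *m r _ _ B).
  elim: l y => [|l IHl] y xy yQ.
    pose u : 'rV[rat]_n := \row_i sval (cid (yQ i (leq0n i))).
    have yE : y = r _ _ u by apply/rowP => i; rewrite !mxE; case: cid.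
    rewrite yE /r -map_mxM; apply: YQ => k; case: (boolP (tight k)) => tk.
      by rewrite tightB.
    have := epsP y (fun i => ltW (xy i)) k tk; rewrite /phi yE /r -!map_mxM mxE ltr0q.
    exact: ltW.
  case: (ltnP l n) => [ln|nl]; last first.
    by apply: IHl => // i; have := ltn_ord i; lia.
  pose i0 := Ordinal ln; pose upd a := \row_i (if i == i0 then a else y 0 i).
  have updY a u : a = ratr u -> `|x 0 i0 - a| < eps -> Y (upd a *m r _ _ B).
    move=> au xa; apply: IHl => i; rewrite mxE; case: eqP => [->|/eqP ii0] //.
      by exists u.
    move=> li; apply: yQ; rewrite ltn_neqAle li andbT.
    by apply: contraNneq ii0 => e; apply/eqP/val_inj.
  have /andP[xy1 xy2] : x 0 i0 - eps < y 0 i0 < x 0 i0 + eps by rewrite -ltr_distlC.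
  have [ua /[!in_itv]/= /andP[xa ay]] := rat_in_itvoo xy1.
  have [ub /[!in_itv]/= /andP[yb bx]] := rat_in_itvoo xy2.
  set a : R := ratr ua in xa ay; set b : R := ratr ub in yb bx.
  have Ya : Y (upd a *m r _ _ B).
    by apply: (updY _ ua) => //; rewrite ltr_distlC xa (lt_trans ay xy2).
  have Yb : Y (upd b *m r _ _ B).
    by apply: (updY _ ub) => //; rewrite ltr_distlC bx (lt_trans xy1 yb).
  have ab : 0 < b - a by rewrite subr_gt0 (lt_trans ay).
  pose t := (b - y 0 i0) / (b - a).
  have t0 : 0 <= t by rewrite divr_ge0 ?subr_ge0 ?ltW // (lt_trans ay).
  have t1 : t <= 1 by rewrite ler_pdivrMr // mul1r lerD2l lerN2 ltW.
  have -> : y = t *: upd a + (1 - t) *: upd b.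
    apply/rowP => i; rewrite !mxE; case: eqP => [->|_]; last by ring.
    by rewrite /t; field; rewrite lt0r_neq0.
  by rewrite mulmxDl -!scalemxAl; apply: convex_set_combination.
rewrite wE; apply: (claim n) => i; first by rewrite subrr normr0.
by rewrite leqNgt ltn_ord.
Qed.

(** * The fundamental cone *)

Section FundamentalCone.
Variables (m n : nat) (H : 'M['F_2]_(m, n)).

Definition in_cone (F : numFieldType) (w : 'rV[F]_n) : Prop :=
  (forall i, 0 <= w 0 i) /\
  (forall j i, i \in bits_of H j -> w 0 i <= \sum_(i' in bits_of H j :\ i) w 0 i').

(** Integer coefficients let one matrix describe the cone over the rationals and over the reals.
    Pairs [(j, i)] with [i] outside [bits_of H j] get a zero column. *)
Lemma cone_constraints : exists (q : nat) (C : 'M[int]_(n, q)),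
  forall (F : numFieldType) (w : 'rV[F]_n),
    (forall k, 0 <= (w *m map_mx intr C) 0 k) <-> in_cone w.
Proof.
pose K : finType := ('I_n + 'I_m * 'I_n)%type.
pose coef (c : K) (i : 'I_n) : int :=
  match c with
  | inl i0 => (i == i0)%:R
  | inr (j, i0) => if i0 \in bits_of H j
                   then (i \in bits_of H j :\ i0)%:R - (i == i0)%:R else 0
  end.
pose C : 'M[int]_(n, #|K|) := \matrix_(i, k) coef (enum_val k) i.
exists #|K|, C => F w.
pose value (c : K) : F := \sum_i w 0 i * (coef c i)%:~R.
have delta i0 : \sum_i w 0 i * (i == i0)%:R = w 0 i0.
  rewrite (bigD1 i0) //= eqxx mulr1 big1 ?addr0 // => i /negbTE ->.
  by rewrite mulr0.
have value_inl i0 : value (inl i0) = w 0 i0.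
  by rewrite -[RHS]delta; apply: eq_bigr => i _; rewrite /= natz -pmulrn.
have value_inr j i0 : i0 \in bits_of H j ->
    value (inr (j, i0)) = \sum_(i' in bits_of H j :\ i0) w 0 i' - w 0 i0.
  move=> ji; rewrite -[w 0 i0]delta big_mkcond -sumrB; apply: eq_bigr => i _.
  rewrite /= ji rmorphB /= !natz -!pmulrn mulrBr; congr (_ - _).
  by case: (i \in _); rewrite ?mulr1 ?mulr0.
have E k : (w *m map_mx intr C) 0 k = value (enum_val k).
  by rewrite mxE; apply: eq_bigr => i _; rewrite !mxE.
have -> : (forall k, 0 <= (w *m map_mx intr C) 0 k) <-> (forall c, 0 <= value c).
  by split=> w0 k; [rewrite -(enum_rankK k) -E | rewrite E].
split=> [w0|[w0 wH] [i|[j i]]].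
- split=> [i|j i ji]; first by rewrite -value_inl.
  by rewrite -subr_ge0 -value_inr.
- by rewrite value_inl.
case: (boolP (i \in bits_of H j)) => ji; first by rewrite value_inr // subr_ge0 wH.
by rewrite /value big1 // => i' _; rewrite /= (negbTE ji) mulr0.
Qed.

Lemma balanced_in_cone (F : numFieldType) (p : 'rV[nat]_n) :
  balanced (normal_graph H) p ->
  in_cone (map_mx (fun k : nat => k%:R : F) p).
Proof.
move=> bp; split=> [i|j i ji]; first by rewrite mxE ler0n.
rewrite mxE; under eq_bigr do rewrite mxE.
rewrite -natr_sum ler_nat -(leq_add2l (p 0 i)) addnn.
have ji' : j \in normal_graph H i by rewrite !inE in ji *.
rewrite (leq_trans ((bp j).2 i ji')) // (bigD1 i) //= leq_add2l.
by apply/eq_leq/eq_bigl => i'; rewrite !inE andbC.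
Qed.

(** The product of all denominators makes the vector integral, and the extra factor 2 makes every
    entry even; the cone inequalities are homogeneous. *)
Lemma in_cone_integral (u : 'rV[rat]_n) : in_cone u ->
  exists (N : nat) (p : 'rV[nat]_n),
    [/\ (0 < N)%N, balanced (normal_graph H) p & forall i, (p 0 i)%:R = N%:R * u 0 i].
Proof.
move=> [u0 uH]; pose d i := `|denq (u ord0 i)|%N.
have d0 i : (0 < d i)%N by rewrite absz_gt0 denq_neq0.
pose N := (2 * \prod_i d i)%N.
pose p : 'rV[nat]_n := \row_i (2 * (`|numq (u ord0 i)| * \prod_(i' | i' != i) d i'))%N.
have numdenq i : `|numq (u ord0 i)|%N%:R = (d i)%:R * u 0 i :> rat.
  by rewrite !natr_absz !ger0_norm ?numq_ge0 ?u0 // numqE mulrC.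
have pE i : (p 0 i)%:R = N%:R * u 0 i.
  have dE : (\prod_i d i = d i * \prod_(i' | i' != i) d i')%N by rewrite (bigD1 i).
  by rewrite mxE /N dE !natrM numdenq; ring.
exists N, p; split=> //; first by rewrite muln_gt0 prodn_gt0.
have N0 : (0 : rat) <= N%:R by rewrite ler0n.
move=> j; split=> [|i ji].
  elim/big_rec: _ => // i x _ ox; rewrite oddD (negbTE ox) addbF mxE.
  by rewrite oddM.
rewrite -(ler_nat rat) -addnn (bigD1 i) //= !natrD lerD2l natr_sum.
under eq_bigr do rewrite pE.
rewrite pE -mulr_sumr ler_wpM2l // (le_trans (uH j i _)) //; first by rewrite !inE in ji *.
rewrite le_eqVlt; apply/orP; left; apply/eqP/eq_bigl => i'.
by rewrite !inE andbC.
Qed.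

(** The cone is convex and contains the balanced vectors. Conversely, a rational point of the cone
    is [p / N] with [p] balanced, so it lies on the segment from the balanced vector 0 to [p], and
    rational points suffice. *)
Lemma newton_polyhedron_cone (R : realType) (f : pseries n) :
  (forall p, f p != 0 <-> balanced (normal_graph H) p) ->
  newton_polyhedron R f = fundamental_cone R H.
Proof.
move=> fP; apply/seteqP; split.
  apply: smallest_sub => [|_ [p /fP bp <-]]; last exact: balanced_in_cone.
  apply: combination_convex_set => x y t [x0 xH] [y0 yH] t0 t1.
  have t1' : 0 <= 1 - t by rewrite subr_ge0.
  split=> [i|j i ji]; rewrite !mxE; first by rewrite addr_ge0 ?mulr_ge0.
  under eq_bigr do rewrite !mxE.
  by rewrite big_split /= -!mulr_sumr lerD // ler_wpM2l // ?xH ?yH.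
move=> w Kw Y [cY AY]; have [q [C CP]] := cone_constraints.
have intY p : balanced (normal_graph H) p ->
    Y (map_mx (fun k : nat => k%:R : R) p).
  by move=> bp; apply: AY; exists p => //; apply/fP.
apply: (@convex_hull_rational_points _ _ _ (map_mx intr C)) => // [u|]; last first.
  by rewrite -map_mx_comp (eq_map_mx _ (ratr_int R)); apply/CP.
move=> /CP/in_cone_integral[N [p [N0 bp pE]]].
have N1 : N%:R^-1 <= 1 :> R by rewrite invf_le1 ?ler1n ?ltr0n.
have -> : map_mx ratr u = N%:R^-1 *: map_mx (fun k : nat => k%:R : R) p +
    (1 - N%:R^-1) *: map_mx (fun k : nat => k%:R : R) 0.
  apply/rowP => i; rewrite !mxE mulr0 addr0 -(ratr_nat R (p 0 i)) pE rmorphM /= ratr_nat.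
  by rewrite mulKf // pnatr_eq0 -lt0n.
apply: convex_set_combination; rewrite ?invr_ge0 ?ler0n //.
  exact: intY.
exact/intY/balanced0.
Qed.

End FundamentalCone.

Theorem corollary5p5 (R : realType) (m n : nat) (H : 'M['F_2]_(m, n))
  (n_gt0 : (0 < n)%N)
  (cycle_code : cycle_code_matrix H)
  (no_multiple_edges : injective (normal_graph H)) :
  [/\ forall p : 'rV[nat]_n, (forall i : 'I_n, (0 < p ord0 i)%N) ->
        ((exists G : seq 'I_n,
            [/\ is_cycle (normal_graph H) G, backtrackless G, tailless G
              & forall i : 'I_n, count_mem i G = p ord0 i]) ->
         unscaled_pseudocodeword H p) /\
        (edge_connected (normal_graph H) ->
         unscaled_pseudocodeword H p ->
         exists G : seq 'I_n,
            [/\ is_cycle (normal_graph H) G, backtrackless G, tailless G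
              & forall i : 'I_n, count_mem i G = p ord0 i]),
      forall p : 'rV[nat]_n,
        unscaled_pseudocodeword H p <-> edge_zeta (normal_graph H) p != 0
    & newton_polyhedron R (edge_zeta (normal_graph H)) = fundamental_cone R H].
Proof.
have zetaP := edge_zeta_neq0P cycle_code.
split=> [p p0|p|]; last exact: newton_polyhedron_cone.
  split=> [[G [cG bG tG Gp]]|connH /pseudocodeword_balanced bp].
    apply: balanced_pseudocodeword.
    have -> : p = multiplicities G by apply/rowP => i; rewrite mxE Gp.
    exact: nb_cycle_balanced.
  have [L [cL Lp]] := balanced_sum_cycles cycle_code bp.
  (* All entries of [p] are positive, so the cycles of the decomposition cover every edge, as
     merging requires. *)
  have cover i : i \in map snd (flatten L).
    by rewrite -has_pred1 has_count Lp.
  have L0 : L != [::] by apply: contraTneq (cover (Ordinal n_gt0)) => ->.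
  have [s cs /seq.permP sL] := merge_connected_cycles cycle_code connH L0 cL cover.
  have [|cG bG tG] := (nb_cycleP (normal_graph H) (map snd s)).2; first by exists s.
  by exists (map snd s); split=> // i; rewrite sL Lp.
split=> [/pseudocodeword_balanced bp|/zetaP bp]; first exact/zetaP.
exact: balanced_pseudocodeword.
Qed.
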